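(* Let $N\geq 1$ and let $f\in C^1(\mathbb{R})$ satisfy $f(0)=0$ and suppose there exists $\delta>0$ such that $f'(s)\leq 0$ for all $|s|<\delta$. Let $u\in C^2(\mathbb{R}^N)$ be a classical solution of $$\Delta u+f(u)=0\quad\text{in }\mathbb{R}^N$$ satisfying $u(x)\to 0$ as $|x|\to\infty$. If $u$ is stable, i.e. $$\int_{\mathbb{R}^N}\left\{|\nabla\varphi|^2-f'(u)\varphi^2\right\}dx\geq 0\quad\text{for all }\varphi\in C_0^\infty(\mathbb{R}^N),$$ then $u\equiv 0$.
   Context: A solution of $\Delta u+f(u)=0$ in $\mathbb{R}^N$ is called stable if the displayed integral inequality holds for every smooth compactly supported test function $\varphi$; otherwise it is called unstable. *)

(* Defs.v *)
From HB Require Import structures.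
From mathcomp Require Import all_boot all_order all_algebra.
From mathcomp Require Import all_classical all_reals all_analysis.
Set Implicit Arguments. Unset Strict Implicit. Unset Printing Implicit Defensive.
Import Order.TTheory GRing.Theory Num.Theory.
Import numFieldNormedType.Exports.
Local Open Scope ring_scope.
Local Open Scope classical_set_scope.

Section Defs.
Variable R : realType.

Definition evec (n : nat) (i : 'I_n) : 'rV[R]_n := delta_mx 0 i.

Definition partial (n : nat) (i : 'I_n) (g : 'rV[R]_n -> R) : 'rV[R]_n -> R :=
  fun x => 'D_(evec i) g x.

Fixpoint Ck (k : nat) (n : nat) (g : 'rV[R]_n -> R) : Prop :=
  continuous g /\
  match k with
  | 0 => True
  | k'.+1 => (forall x, differentiable g x) /\ (forall i, Ck k' (partial i g))
  end.

Definition smooth (n : nat) (g : 'rV[R]_n -> R) : Prop := forall k, Ck k g.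

Definition compact_support (n : nat) (g : 'rV[R]_n -> R) : Prop :=
  exists r : R, forall x, r < `|x| -> g x = 0.

Definition test_fun (n : nat) (g : 'rV[R]_n -> R) : Prop :=
  smooth g /\ compact_support g.

Definition C1R (f : R -> R) : Prop :=
  (forall s, derivable f s 1) /\ continuous (derive1 f).

Definition laplacian (n : nat) (g : 'rV[R]_n -> R) (x : 'rV[R]_n) : R :=
  \sum_(i < n) partial i (partial i g) x.

Definition grad_sq (n : nat) (g : 'rV[R]_n -> R) (x : 'rV[R]_n) : R :=
  \sum_(i < n) (partial i g x) ^+ 2.

(* Integral over R^n, computed as the iterated Lebesgue integral over the
   coordinates (used only for continuous compactly supported integrands,
   for which it coincides with the Lebesgue integral on R^n by Fubini). *)
Fixpoint integral_Rn (n : nat) : ('rV[R]_n -> R) -> R :=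
  match n return ('rV[R]_n -> R) -> R with
  | 0 => fun g => g 0
  | k.+1 => fun g =>
      Rintegral (@lebesgue_measure R) setT
        (fun t : R => integral_Rn (fun v : 'rV[R]_k =>
                          g (row_mx (const_mx t : 'rV[R]_1) v)))
  end.

Definition vanishes_at_infinity (n : nat) (u : 'rV[R]_n -> R) : Prop :=
  forall e : R, 0 < e -> exists r : R, forall x, r < `|x| -> `|u x| < e.

Definition stable (n : nat) (f : R -> R) (u : 'rV[R]_n -> R) : Prop :=
  forall phi : 'rV[R]_n -> R, test_fun phi ->
    0 <= integral_Rn (fun x => grad_sq phi x - derive1 f (u x) * (phi x) ^+ 2).

End Defs.

(* Main.v *)
Require Import Defs.
From HB Require Import structures.
From mathcomp Require Import all_boot all_order all_algebra.
From mathcomp Require Import all_classical all_reals all_analysis.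
From mathcomp Require Import ring lra zify.
Import Order.TTheory GRing.Theory Num.Theory.
Import numFieldNormedType.Exports.
Local Open Scope ring_scope.
Set Implicit Arguments. Unset Strict Implicit. Unset Printing Implicit Defensive.

(** Let [w] be the first partial derivative of [u]; it solves the linearized equation
    [Lap w + f'(u) w = 0] weakly.  Testing the equation against [u z^2] far away, where
    [f(u) u <= 0], bounds [grad u] on large annuli by [u]; together with the decay of [u]
    (trivial for [n <= 4], by comparison with a power of [|x|^2] otherwise) this shows that the
    cutoffs [eta w^+] have energy [Q(eta w^+) <= int w^2 |grad eta|^2 -> 0].  By stability [w^+]
    is then a null vector of [Q], so [Q(w^+, chi) = 0] for every test function [chi].  If [w]
    changed sign, a Hopf barrier [chi] centered at a point where [w < 0], which is a strict
    subsolution wherever [w > 0], would contradict this.  Hence [w] has a sign, [u] is monotone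
    along the lines parallel to the first axis, and it tends to [0] at both ends. *)

(** The limit in the overview is never taken: the contradiction is reached inside a single test
    function with fixed parameters, so only continuous compactly supported functions are ever
    integrated. Two defects of regularity shape the rest. As [f] is only [C^1] and [u] only [C^2],
    [w] is merely [C^1], so its equation is weak; and [w^+] is not [C^1], so it is replaced by a
    smoothed truncation [G(w)] whose error is made small after the cutoff radius is fixed.
    Stability, given on smooth functions, is extended to [C^1] ones by mollification. The dimension
    4 is the price of two cutoffs: [|grad eta|^2] contributes [r^-2] and the bound of [grad u] by
    [u] another [r^-2], so the tail is at most a constant times [r^(n-4) sup u^2] over an annulus.
    For [n > 4] this asks for slightly more than [u = O(r^(-(n-4)/2))], far weaker than the decay
    [r^(2-n)] of the fundamental solution, which leaves room for an integer power of [|x|^2]. The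
    barrier stands in for the strong maximum principle: it is paired with the truncation directly,
    so no regularity or unique continuation for the null vector [w^+] is needed. *)

Section continuity.
Context {R : realType}.

Lemma continuous_epsP (V W : normedModType R) (g : V -> W) (x : V) :
  {for x, continuous g} <-> forall e : R, 0 < e -> exists2 d : R, 0 < d &
    forall y, `|y - x| < d -> `|g y - g x| < e.
Proof.
split=> [cg e e0|cg].
  have /cvgrPdistC_lt/(_ _ e0)/nbhs_ballP[d /= d0 H] := cg.
  exists d => // y yx; apply: H.
  by rewrite -ball_normE /= distrC.
apply/cvgrPdistC_lt => e /cg[d d0 H]; apply/nbhs_ballP; exists d => //= y.
by rewrite -ball_normE /= distrC => /H.
Qed.

Lemma closed_ball_rV_compact n (r : R) :
  compact [set x : 'rV[R]_n | `|x| <= r].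
Proof.
apply: bounded_closed_compact.
  exists r; split; first exact: num_real.
  by move=> M rM x /= xr; exact: le_trans xr (ltW rM).
exact: (closed_comp (fun x _ => @norm_continuous _ _ x) (@closed_le _ r)).
Qed.

Lemma continuous_bounded_rV n (g : 'rV[R]_n -> R) (r : R) : continuous g ->
  exists2 M, 0 <= M & forall x, `|x| <= r -> `|g x| <= M.
Proof.
move=> cg; have [r0|r0] := ltP r 0.
  by exists 0 => // x /le_lt_trans/(_ r0); rewrite normr_lt0.
have [|||c _ cmax] := @EVT_max_rV R n (fun x => `|g x|)
    [set x : 'rV[R]_n | `|x| <= r].
- by exists 0; rewrite /= normr0.
- exact: closed_ball_rV_compact.
- apply: continuous_subspaceT => x.
  by apply: (continuous_comp (cg x)); exact: norm_continuous.
- by exists `|g c| => // x xr; apply: cmax; rewrite inE.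
Qed.

(** Only [x] is confined to the ball, while [y] may leave it; shifted arguments can then be compared
    without enlarging the radius. The modulus comes from compactness of the ball in its
    near-covering form. *)
Lemma continuous_unif_rV n (g : 'rV[R]_n -> R) (r e : R) : continuous g ->
  0 < e -> exists2 d, 0 < d &
    forall x y, `|x| <= r -> `|y - x| < d -> `|g y - g x| < e.
Proof.
move=> cg e0.
have /compact_near_coveringP := @closed_ball_rV_compact n r.
move=> /(_ _ _ (fun (d : R) x => forall y, `|y - x| < d -> `|g y - g x| < e)
  (at_right_proper_filter (0 : R))) [].
- move=> x _; have e20 : 0 < e / 2 by rewrite divr_gt0.
  have /continuous_epsP/(_ _ e20)[d d0 H] := cg x.
  exists (ball x (d / 2), [set t : R | t < d / 2]%classic).
    split; first by apply: nbhsx_ballx; rewrite divr_gt0.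
    by apply: nbhs_right_lt; rewrite divr_gt0.
  move=> [x' t] [/= ]; rewrite -ball_normE /= distrC => xx' td y yx'.
  have -> : g y - g x' = (g y - g x) - (g x' - g x) by ring.
  rewrite (le_lt_trans (ler_normB _ _)) //.
  have h1 : `|g y - g x| < e / 2.
    apply: H; have -> : y - x = (y - x') + (x' - x) by rewrite addrA subrK.
    by rewrite (le_lt_trans (ler_normD _ _)) //; lra.
  have h2 : `|g x' - g x| < e / 2 by apply: H; lra.
  by lra.
- move=> d /= d0 H; exists (d / 2); first by rewrite divr_gt0.
  move=> x y xr; apply: (H (d / 2)) => //=; last by rewrite divr_gt0.
  by rewrite sub0r normrN gtr0_norm ?divr_gt0 //; lra.
Qed.

Section continuity_operations.
Variable T : topologicalType.
Implicit Types f g : T -> R.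

Lemma contD f g : continuous f -> continuous g -> continuous (fun x => f x + g x).
Proof. by move=> cf cg x; apply: cvgD; [exact: cf|exact: cg]. Qed.

Lemma contM f g : continuous f -> continuous g -> continuous (fun x => f x * g x).
Proof. by move=> cf cg x; apply: cvgM; [exact: cf|exact: cg]. Qed.

Lemma contN f : continuous f -> continuous (fun x => - f x).
Proof. by move=> cf x; apply: cvgN; exact: cf. Qed.

Lemma contB f g : continuous f -> continuous g -> continuous (fun x => f x - g x).
Proof. by move=> cf cg x; apply: cvgB; [exact: cf|exact: cg]. Qed.

Lemma cont_cst (a : R) : continuous (fun _ : T => a).
Proof. exact: cst_continuous. Qed.

Lemma contX f k : continuous f -> continuous (fun x => f x ^+ k).
Proof.
move=> cf; elim: k => [|k IH]; first exact: cont_cst.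
by under [fun _ => _]funext do rewrite exprS; exact: contM.
Qed.

Lemma cont_sum (I : finType) (F : I -> T -> R) : (forall i, continuous (F i)) ->
  continuous (fun x => \sum_i F i x).
Proof.
move=> cF; rewrite /index_enum; elim: (Finite.enum I) => [|i s IHs].
  by under [fun _ => _]funext do rewrite big_nil; exact: cont_cst.
by under [fun _ => _]funext do rewrite big_cons; exact: contD.
Qed.

Lemma cont_comp (U : topologicalType) (f : T -> U) (g : U -> R) :
  continuous f -> continuous g -> continuous (fun x => g (f x)).
Proof. by move=> cf cg x; exact: (continuous_comp (cf x) (cg _)). Qed.

End continuity_operations.

Lemma cont_shift (V : normedModType R) (a : V) : continuous (fun x : V => x + a).
Proof. by move=> x; apply: cvgD; [exact: cvg_id|exact: cvg_cst]. Qed.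

Lemma cont_affine (V : normedModType R) (x : V) (s : R) :
  continuous (fun y : V => x + s *: y).
Proof.
move=> y; apply: cvgD; [exact: cvg_cst|exact: scaler_continuous].
Qed.

Lemma is_derive_cont (f : R -> R) (df : R -> R) :
  (forall x, is_derive x (1 : R) f (df x)) -> continuous f.
Proof.
by move=> H x; apply/differentiable_continuous/derivable1_diffP; have [] := H x.
Qed.

End continuity.

(** * Continuous functions with compact support *)

Section compactly_supported.
Context {R : realType}.

Definition Cc (V : normedModType R) (g : V -> R) :=
  continuous g /\ exists2 r : R, 0 <= r & forall x, r < `|x| -> g x = 0.

Variable V : normedModType R.
Implicit Types g h : V -> R.

Lemma Cc0 : Cc (fun _ : V => 0).
Proof. by split; [exact: cst_continuous|exists 0]. Qed.

Lemma CcD g h : Cc g -> Cc h -> Cc (fun x => g x + h x).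
Proof.
move=> [cg [r r0 gr]] [ch [s s0 hs]]; split.
  by move=> x; apply: cvgD; [exact: cg|exact: ch].
exists (Num.max r s); first by rewrite le_max r0.
by move=> x; rewrite gt_max => /andP[rx sx]; rewrite gr // hs // addr0.
Qed.

Lemma CcMl g h : continuous g -> Cc h -> Cc (fun x => g x * h x).
Proof.
move=> cg [ch [s s0 hs]]; split.
  by move=> x; apply: cvgM; [exact: cg|exact: ch].
by exists s => // x sx; rewrite hs // mulr0.
Qed.

Lemma CcMr g h : Cc g -> continuous h -> Cc (fun x => g x * h x).
Proof.
by move=> ? ?; under [fun _ => _]funext do rewrite mulrC; exact: CcMl.
Qed.

Lemma CcZ a g : Cc g -> Cc (fun x => a * g x).
Proof. by apply: CcMl => x; exact: cvg_cst. Qed.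

Lemma CcN g : Cc g -> Cc (fun x => - g x).
Proof.
by move=> /(CcZ (-1)); under [fun _ => _]funext do rewrite mulN1r.
Qed.

Lemma CcB g h : Cc g -> Cc h -> Cc (fun x => g x - h x).
Proof. by move=> ? /CcN; exact: CcD. Qed.

Lemma Cc_norm g : Cc g -> Cc (fun x => `|g x|).
Proof.
move=> [cg [r r0 gr]]; split.
  by move=> x; apply: (continuous_comp (cg x)); exact: norm_continuous.
by exists r => // x /gr ->; rewrite normr0.
Qed.

Lemma Cc_sum (I : finType) (F : I -> V -> R) :
  (forall i, Cc (F i)) -> Cc (fun x => \sum_i F i x).
Proof.
move=> cF; rewrite /index_enum; elim: (Finite.enum I) => [|i s IHs].
  under [fun _ => _]funext do rewrite big_nil.
  exact: Cc0.
by under [fun _ => _]funext do rewrite big_cons; exact: CcD.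
Qed.

Lemma Cc_shift g a : Cc g -> Cc (fun x => g (x + a)).
Proof.
move=> [cg [r r0 gr]]; split.
  move=> x; apply: (@continuous_comp _ _ _ (fun x => x + a) g); last exact: cg.
  by apply: cvgD; [exact: cvg_id|exact: cvg_cst].
exists (r + `|a|); first by rewrite addr_ge0.
move=> x rx; apply: gr; have := ler_normB (x + a) a; rewrite addrK; lra.
Qed.

Lemma Cc_neg g : Cc g -> Cc (fun x => g (- x)).
Proof.
move=> [cg [r r0 gr]]; split.
  move=> x; apply: (@continuous_comp _ _ _ (fun x => - x) g); last exact: cg.
  exact: opp_continuous.
by exists r => // x rx; apply: gr; rewrite normrN.
Qed.

End compactly_supported.

(** * Integration of compactly supported continuous functions *)

Section integral_R.
Context {R : realType}.
Local Notation mu := (@lebesgue_measure R).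
Local Notation J g := (Rintegral mu setT g).

Lemma Cc_integrable (g : R -> R) : Cc g -> mu.-integrable setT (EFin \o g).
Proof.
move=> [cg [r r0 gr]].
have -> : EFin \o g = (EFin \o g) \_ `[(- r), r]%classic.
  apply/funext => x; rewrite /patch; case: ifPn => //.
  rewrite notin_setE /= in_itv /= => /negP; rewrite -ler_norml -ltNge => /gr.
  by move=> /= ->.
apply: (integrable_mkcond _ _).1 => //.
apply: continuous_compact_integrable; first exact: segment_compact.
exact: continuous_subspaceT.
Qed.

Lemma Rintegral_Cc_bound (g : R -> R) (r M : R) : 0 <= r -> continuous g ->
  (forall x, r < `|x| -> g x = 0) -> (forall x, `|g x| <= M) ->
  `|J g| <= M * (2 * r).
Proof.
move=> r0 cg gr gM.
have Cg : Cc g by split => //; exists r.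
apply: (le_trans (le_normr_Rintegral measurableT (Cc_integrable Cg))).
have -> : J (fun t => `|g t|) = \int[mu]_(x in `[(- r), r]) `|g x|.
  rewrite [RHS]Rintegral_mkcond; apply: eq_Rintegral => x _; rewrite /patch.
  case: ifPn => //; rewrite notin_setE /= in_itv /= => /negP.
  by rewrite -ler_norml -ltNge => /gr ->; rewrite normr0.
have -> : M * (2 * r) = \int[mu]_(x in `[(- r), r]) M.
  rewrite Rintegral_cst; last exact: measurable_itv.
  rewrite [fine _](_ : _ = fine (lebesgue_measure `[(- r), r]%classic)) //.
  rewrite lebesgue_measure_itv /= lte_fin.
  case: ltP => h /=; first by rewrite opprK; ring.
  have -> : r = 0 by lra.
  by rewrite mulr0.
apply: le_Rintegral => //.
- apply: continuous_compact_integrable; first exact: segment_compact.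
  by apply: continuous_subspaceT => x; exact: (Cc_norm Cg).1.
- apply: continuous_compact_integrable; first exact: segment_compact.
  by apply: continuous_subspaceT => x; exact: cvg_cst.
Qed.

Lemma Rintegral_Cc_lin (a : R) (g h : R -> R) : Cc g -> Cc h ->
  J (fun t => a * g t + h t) = a * J g + J h.
Proof.
move=> Cg Ch; rewrite RintegralD //; first by rewrite RintegralZl //; exact: Cc_integrable.
- by apply: Cc_integrable; exact: CcZ.
- exact: Cc_integrable.
Qed.

Lemma Rintegral_Cc_gt0 (g : R -> R) (t0 : R) : Cc g -> (forall t, 0 <= g t) ->
  0 < g t0 -> 0 < J g.
Proof.
move=> Cg g0 gt0; have g20 : 0 < g t0 / 2 by rewrite divr_gt0.
have /continuous_epsP/(_ _ g20)[d d0 H] := Cg.1 t0.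
pose A := `[(t0 - d / 2), (t0 + d / 2)]%classic.
apply: (@lt_le_trans _ _ (\int[mu]_(x in A) (g t0 / 2))).
  rewrite Rintegral_cst; last exact: measurable_itv.
  rewrite mulr_gt0 // [fine _](_ : _ = fine (lebesgue_measure A)) //.
  rewrite /A lebesgue_measure_itv /= lte_fin ifT /=; lra.
rewrite Rintegral_mkcond.
have intA : mu.-integrable setT (EFin \o ((fun=> g t0 / 2) \_ A)).
  rewrite -restrict_EFin; apply: (integrable_mkcond _ _).1.
    exact: measurable_itv.
  apply: continuous_compact_integrable; first exact: segment_compact.
  by apply: continuous_subspaceT => x; exact: cvg_cst.
apply: le_Rintegral => //; first exact: Cc_integrable.
move=> x _; rewrite /patch; case: ifPn => // /set_mem.
rewrite /A /= in_itv /= => /andP[h1 h2].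
have : `|g x - g t0| < g t0 / 2.
  by apply: H; rewrite ltr_norml; apply/andP; split; lra.
by rewrite ltr_norml => /andP[]; lra.
Qed.

Lemma Rintegral_shift_ge0 (g : R -> R) (a : R) : continuous g ->
  (forall t, 0 <= g t) -> J (fun t => g (t + a)) = J g.
Proof.
move=> cg g0; rewrite /Rintegral; congr fine.
have dF x : is_derive (x : R) (1 : R) (fun t : R => t + a) 1.
  by apply: is_derive_eq; rewrite addr0.
have F'1 : (fun t : R => t + a)^`()%classic = cst 1.
  by apply/funext => x; rewrite derive1E; exact: (@derive_val _ _ _ _ _ _ _ (dF x)).
rewrite (@increasing_ge0_integration_by_substitutionT _ (fun t => t + a) g) //.
- by apply: eq_integral => x _; rewrite F'1 /= mulr1.
- by move=> x y xy /=; rewrite ltrD2r.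
- by rewrite F'1 => x; exact: cvg_cst.
- by rewrite F'1; exact: is_cvg_cst.
- by rewrite F'1; exact: is_cvg_cst.
- apply/cvgrNyPle => A; near=> x; rewrite -lerBrDr; near: x.
  by apply: nbhs_ninfty_le; exact: num_real.
- apply/cvgryPge => A; near=> x; rewrite -lerBlDr; near: x.
  by apply: nbhs_pinfty_ge; exact: num_real.
Unshelve. all: by end_near.
Qed.

(** A signed [g] is the difference of the nonnegative functions [g + |g|] and [|g|], to which
    substitution applies. *)
Lemma Rintegral_Cc_shift (g : R -> R) (a : R) : Cc g ->
  J (fun t => g (t + a)) = J g.
Proof.
move=> Cg.
have Cn := Cc_norm Cg.
have Cp : Cc (fun t => g t + `|g t|) by exact: CcD.
have E h : Cc h -> Cc (fun t => `|h t|) -> J h = J (fun t => h t + `|h t|) - J (fun t => `|h t|).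
  move=> Ch Cnh; rewrite RintegralD ?addrK //; exact: Cc_integrable.
rewrite (E (fun t => g (t + a))); [|exact: Cc_shift|exact: (Cc_shift a Cn)].
rewrite (E g) //; congr (_ - _).
  apply: (Rintegral_shift_ge0 a Cp.1) => t.
  by have := ler_normr (- g t) (- g t); rewrite normrN lexx /=; lra.
exact: (Rintegral_shift_ge0 a Cn.1).
Qed.

End integral_R.

(** * Linearity, bounds, translation invariance and positivity of the iterated integral *)

Section integral_Rn_theory.
Context {R : realType}.
Local Notation mu := (@lebesgue_measure R).
Local Notation J g := (Rintegral mu setT g).
Local Notation cons_rV t v := (row_mx (const_mx t : 'rV_1) v).

Lemma coord_le_norm n (x : 'rV[R]_n) i : `|x 0 i| <= `|x|.
Proof.
rewrite [X in _ <= X]/Num.Def.normr /= mx_normrE.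
exact: (le_bigmax _ (fun ij : 'I_1 * 'I_n => `|x ij.1 ij.2|) (0, i)).
Qed.

Lemma norm_le_coord n (x : 'rV[R]_n) (r : R) : 0 <= r ->
  (forall i, `|x 0 i| <= r) -> `|x| <= r.
Proof.
move=> r0 H; rewrite /Num.Def.normr /= mx_normrE; apply/bigmax_leP; split => //= -[a b] _ /=.
by rewrite ord1.
Qed.

Lemma norm_lt_coord n (x : 'rV[R]_n) (r : R) : 0 < r ->
  (forall i, `|x 0 i| < r) -> `|x| < r.
Proof.
move=> r0 H; rewrite /Num.Def.normr /= mx_normrE; apply/bigmax_ltP; split => //= -[a b] _ /=.
by rewrite ord1.
Qed.

Lemma norm_cons_rV_ge k (t : R) (v : 'rV[R]_k) :
  `|t| <= `|cons_rV t v| /\ `|v| <= `|cons_rV t v|.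
Proof.
split.
  have := @coord_le_norm _ (cons_rV t v) (@lshift 1 k ord0).
  by rewrite row_mxEl mxE.
apply: norm_le_coord => // i.
have := @coord_le_norm _ (cons_rV t v) (rshift 1 i).
by rewrite row_mxEr.
Qed.

Lemma cons_rV_dist k (s t : R) (v w : 'rV[R]_k) (e : R) :
  `|s - t| < e -> `|v - w| < e -> `|cons_rV s v - cons_rV t w| < e.
Proof.
move=> st vw; rewrite opp_row_mx add_row_mx.
apply: norm_lt_coord; first by rewrite (le_lt_trans _ st).
move=> i; case: (splitP i) => j ij.
  have -> : i = lshift k j by apply: val_inj.
  by rewrite row_mxEl !mxE.
have -> : i = rshift 1 j by apply: val_inj.
by rewrite row_mxEr (le_lt_trans (coord_le_norm _ _)).
Qed.

Lemma cons_rVE k (x : 'rV[R]_(1 + k)) :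
  x = cons_rV (x 0 (lshift k ord0)) (rsubmx x).
Proof.
rewrite -[LHS]hsubmxK; congr row_mx.
by apply/rowP => i; rewrite !mxE ord1.
Qed.

Lemma slice_Cc k (g : 'rV[R]_(1 + k) -> R) (t : R) : Cc g ->
  Cc (fun v : 'rV[R]_k => g (cons_rV t v)).
Proof.
move=> [cg [r r0 gr]]; split.
  move=> v; apply/continuous_epsP => e e0.
  have /continuous_epsP/(_ _ e0)[d d0 H] := cg (cons_rV t v).
  exists d => // w wv; apply: H; apply: cons_rV_dist => //.
  by rewrite subrr normr0.
exists r => // v rv; apply: gr.
exact: lt_le_trans rv (norm_cons_rV_ge t v).2.
Qed.

(** The four facts are bundled for one induction on the dimension: each of them in dimension [k + 1]
    needs the slice integrals to be continuous, and that continuity needs linearity and the bound in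
    dimension [k]. The factor [(2 * r) ^+ n] is the volume of a ball of the sup norm, which is the
    norm of row vectors. *)
Definition integral_props n := 
  [/\ forall (a : R) (g h : 'rV[R]_n -> R), Cc g -> Cc h ->
       integral_Rn (fun x => a * g x + h x) = a * integral_Rn g + integral_Rn h,
     forall (g : 'rV[R]_n -> R) r M, 0 <= r -> continuous g ->
       (forall x, r < `|x| -> g x = 0) -> (forall x, `|g x| <= M) ->
       `|integral_Rn g| <= M * (2 * r) ^+ n,
     forall (g : 'rV[R]_n -> R) a, Cc g ->
       integral_Rn (fun x => g (x + a)) = integral_Rn g &
     forall (g : 'rV[R]_n -> R), Cc g -> (forall x, 0 <= g x) ->
       0 <= integral_Rn g /\ forall x0, 0 < g x0 -> 0 < integral_Rn g ].

(** Uniform continuity of [g] makes two nearby slices uniformly close, and the bound in dimension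
    [k] turns this into closeness of their integrals. *)
Lemma slice_integral_Cc k (g : 'rV[R]_(1 + k) -> R) : integral_props k -> Cc g ->
  Cc (fun t => integral_Rn (fun v : 'rV[R]_k => g (cons_rV t v))).
Proof.
move=> [lin bnd _ _] Cg; have [cg [r r0 gr]] := Cg; split; last first.
  exists r => // t rt; apply/eqP; rewrite -normr_le0.
  rewrite -(mul0r ((2 * r) ^+ k)); apply: bnd => //.
  - exact: (slice_Cc t Cg).1.
  - by move=> v rv; apply: gr; exact: lt_le_trans rv (norm_cons_rV_ge t v).2.
  - by move=> v; rewrite gr ?normr0 //; exact: lt_le_trans rt (norm_cons_rV_ge t v).1.
move=> t; apply/continuous_epsP => e e0.
(* The added 1 keeps the divisor positive when [r = 0]. *)
have P0 : 0 < (2 * r) ^+ k + 1 by rewrite ltr_wpDl // exprn_ge0 // mulr_ge0.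
have e'0 : 0 < e / ((2 * r) ^+ k + 1) by rewrite divr_gt0.
have [d d0 H] := continuous_unif_rV (Num.max r `|t|) cg e'0.
exists d => // s st.
have -> : integral_Rn (fun v : 'rV_k => g (cons_rV s v)) -
    integral_Rn (fun v : 'rV_k => g (cons_rV t v)) =
    integral_Rn (fun v : 'rV_k => -1 * g (cons_rV t v) + g (cons_rV s v)).
  by rewrite lin ?mulN1r 1?addrC //; exact: slice_Cc.
apply: (@le_lt_trans _ _ (e / ((2 * r) ^+ k + 1) * (2 * r) ^+ k)).
  apply: bnd => //.
  - by apply: (CcD (CcZ _ (slice_Cc t Cg)) (slice_Cc s Cg)).1.
  - move=> v rv.
    rewrite !gr ?mulr0 ?addr0 //; exact: lt_le_trans rv (norm_cons_rV_ge _ v).2.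
  - move=> v; have [vr|rv] := leP `|v| r; last first.
      rewrite !gr ?mulr0 ?addr0 ?normr0 ?ltW //; exact: lt_le_trans rv (norm_cons_rV_ge _ v).2.
    rewrite mulN1r addrC ltW //; apply: H; last first.
      by apply: cons_rV_dist => //; rewrite subrr normr0.
    apply: norm_le_coord => [|i]; first by rewrite le_max r0.
    case: (splitP i) => j ij.
      have -> : i = lshift k j by apply: val_inj.
      by rewrite row_mxEl !mxE le_max lexx orbT.
    have -> : i = rshift 1 j by apply: val_inj.
    by rewrite row_mxEr le_max (le_trans (coord_le_norm _ _)).
by rewrite mulrAC ltr_pdivrMr // ltr_pM2l // ltrDl.
Qed.

Lemma integral_propsP n : integral_props n.
Proof.
elim: n => [|k IH].
  split=> //=.
  - by move=> g r M r0 cg gr gM; rewrite expr0 mulr1.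
  - by move=> g a _; congr g; apply/rowP; case.
  - move=> g Cg g0; split => // x0; suff -> : x0 = 0 by [].
    by apply/rowP; case.
have SC := slice_integral_Cc IH; have [lin bnd tr pos] := IH.
split.
- move=> a g h Cg Ch /=; rewrite -Rintegral_Cc_lin; [|exact: SC|exact: SC].
  by apply: eq_Rintegral => t _; apply: lin; exact: slice_Cc.
- move=> g r M r0 cg gr gM; have Cg : Cc g by split => //; exists r.
  rewrite /= exprSr mulrA; apply: Rintegral_Cc_bound => //.
  + exact: (SC _ Cg).1.
  + move=> t rt; apply/eqP; rewrite -normr_le0.
    rewrite -(mul0r ((2 * r) ^+ k)); apply: bnd => //.
    * exact: (slice_Cc t Cg).1.
    * by move=> v rv; apply: gr; exact: lt_le_trans rv (norm_cons_rV_ge t v).2.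
    * by move=> v; rewrite gr ?normr0 //; exact: lt_le_trans rt (norm_cons_rV_ge t v).1.
  + move=> t; apply: bnd => //; first exact: (slice_Cc t Cg).1.
    by move=> v rv; apply: gr; exact: lt_le_trans rv (norm_cons_rV_ge t v).2.
- move=> g a Cg.
  have a_cons := cons_rVE (a : 'rV_(1 + k)).
  pose G t := integral_Rn (fun v : 'rV[R]_k => g (cons_rV t v)).
  rewrite /= -(Rintegral_Cc_shift (a 0 (@lshift 1 k ord0)) (SC _ Cg)).
  apply: eq_Rintegral => t _.
  rewrite -(tr _ (rsubmx (a : 'rV_(1 + k))) (slice_Cc _ Cg)).
  congr integral_Rn; apply/funext => v; congr g.
  transitivity (cons_rV t v + cons_rV (a 0 (@lshift 1 k ord0))
      (rsubmx (a : 'rV_(1 + k)))); first by congr (_ + _).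
  have E (s1 s2 : R) : const_mx s1 + const_mx s2 = const_mx (s1 + s2) :> 'rV_1.
    by apply/rowP => i; rewrite !mxE.
  by rewrite add_row_mx E.
- move=> g Cg g0.
  have G0 t : 0 <= integral_Rn (fun v : 'rV[R]_k => g (cons_rV t v)).
    by apply: (pos _ (slice_Cc t Cg) _).1.
  split; first by apply: Rintegral_ge0.
  move=> x0 gx0; apply: (@Rintegral_Cc_gt0 _ _ (x0 0 (@lshift 1 k ord0)) (SC _ Cg)) => //.
  apply: (pos _ (slice_Cc _ Cg) _).2 => //; last first.
    by move: gx0; rewrite {1}(cons_rVE (x0 : 'rV_(1 + k))); exact.
Qed.

End integral_Rn_theory.

Section integral_Rn_calculus.
Context {R : realType} {n : nat}.
Implicit Types g h : 'rV[R]_n -> R.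
Local Notation I := (@integral_Rn R n).

Lemma int_lin (a : R) g h : Cc g -> Cc h ->
  I (fun x => a * g x + h x) = a * I g + I h.
Proof. by case: (@integral_propsP R n) => H _ _ _; exact: H. Qed.

Lemma int_bound g r M : 0 <= r -> continuous g -> (forall x, r < `|x| -> g x = 0) ->
  (forall x, `|g x| <= M) -> `|I g| <= M * (2 * r) ^+ n.
Proof. by case: (@integral_propsP R n) => _ H _ _; exact: H. Qed.

Lemma int_shift g a : Cc g -> I (fun x => g (x + a)) = I g.
Proof. by case: (@integral_propsP R n) => _ _ H _; exact: H. Qed.

Lemma int_ge0 g : Cc g -> (forall x, 0 <= g x) -> 0 <= I g.
Proof.
by case: (@integral_propsP R n) => _ _ _ H Cg g0; case: (H _ Cg g0).
Qed.

Lemma int_gt0 g x0 : Cc g -> (forall x, 0 <= g x) -> 0 < g x0 -> 0 < I g.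
Proof.
by case: (@integral_propsP R n) => _ _ _ H Cg g0; case: (H _ Cg g0) => _; exact.
Qed.

Lemma int0 : I (fun=> 0) = 0.
Proof.
have C0 := @Cc0 R 'rV[R]_n.
by have := int_lin (-1) C0 C0; under [fun _ => _]funext do rewrite mulr0 addr0;
  move=> ->; rewrite mulN1r addNr.
Qed.

Lemma intD g h : Cc g -> Cc h -> I (fun x => g x + h x) = I g + I h.
Proof.
by move=> Cg Ch; rewrite -[I g]mul1r -int_lin //; congr I; apply/funext => x;
  rewrite mul1r.
Qed.

Lemma intZ a g : Cc g -> I (fun x => a * g x) = a * I g.
Proof.
move=> Cg; have C0 := @Cc0 R 'rV[R]_n.
by rewrite -[RHS]addr0 -int0 -int_lin //; congr I; apply/funext => x; rewrite addr0.
Qed.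

Lemma intN g : Cc g -> I (fun x => - g x) = - I g.
Proof.
by move=> Cg; rewrite -mulN1r -intZ //; congr I; apply/funext => x; rewrite mulN1r.
Qed.

Lemma intB g h : Cc g -> Cc h -> I (fun x => g x - h x) = I g - I h.
Proof. by move=> Cg Ch; rewrite -intN // -intD //; exact: CcN. Qed.

Lemma int_le g h : Cc g -> Cc h -> (forall x, g x <= h x) -> I g <= I h.
Proof.
move=> Cg Ch gh; rewrite -subr_ge0 -intB //; apply: int_ge0; first exact: CcB.
by move=> x; rewrite subr_ge0.
Qed.

Lemma int_sum (T : finType) (F : T -> 'rV[R]_n -> R) : (forall i, Cc (F i)) ->
  I (fun x => \sum_i F i x) = \sum_i I (F i).
Proof.
move=> CF; rewrite /index_enum.
suff : Cc (fun x => \sum_(i <- Finite.enum T) F i x) /\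
   I (fun x => \sum_(i <- Finite.enum T) F i x) = \sum_(i <- Finite.enum T) I (F i).
  by case.
elim: (Finite.enum T) => [|i s [Cs IHs]].
  under [fun _ => _]funext do rewrite big_nil.
  rewrite big_nil int0; split=> //.
  exact: Cc0.
under [fun _ => _]funext do rewrite big_cons.
by rewrite big_cons intD // IHs; split=> //; exact: CcD.
Qed.

End integral_Rn_calculus.

(** * Directional derivatives and C^1 functions *)

Section directional_derivatives.
Context {R : realType} {V : normedModType R}.
Implicit Types (g : V -> R) (x v : V).

Lemma is_derive_line g x v (t d : R) : is_derive (t *: v + x) v g d ->
  is_derive t (1 : R) (fun s : R => g (s *: v + x)) d.
Proof.
have E : (fun h : R => h^-1 *: (((fun s : R => g (s *: v + x)) \o shift t) (h *: (1 : R)) -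
    g (t *: v + x))) = (fun h => h^-1 *: ((g \o shift (t *: v + x)) (h *: v) - g (t *: v + x))).
  apply/funext => h /=; congr (_ *: (g _ - _)).
  by rewrite [h *: 1]mulr1 scalerDl addrA.
by move=> [dg dgE]; split; [rewrite /derivable E|rewrite /derive E].
Qed.

Lemma is_derive_line0 g x v d :
  is_derive (0 : R) (1 : R) (fun s : R => g (s *: v + x)) d -> is_derive x v g d.
Proof.
have E : (fun h : R => h^-1 *: (((fun s : R => g (s *: v + x)) \o shift (0 : R)) (h *: (1 : R)) -
    g ((0 : R) *: v + x))) = (fun h => h^-1 *: ((g \o shift x) (h *: v) - g x)).
  apply/funext => h /=; congr (_ *: (g _ - g _)).
    by rewrite [h *: 1]mulr1 addr0.
  by rewrite scale0r add0r.
by move=> [dg dgE]; split; [rewrite /derivable -E|rewrite /derive -E].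
Qed.

Lemma is_derive_comp (f : R -> R) g x v (df dg : R) :
  is_derive (g x) (1 : R) f df -> is_derive x v g dg ->
  is_derive x v (fun y => f (g y)) (df * dg).
Proof.
move=> Hf Hg; apply: is_derive_line0.
have Hg' : is_derive (0 : R) (1 : R) (fun s : R => g (s *: v + x)) dg.
  by apply: is_derive_line; rewrite scale0r add0r.
apply: (@is_derive1_comp _ f (fun s : R => g (s *: v + x))) => //.
by rewrite scale0r add0r.
Qed.

Lemma is_derive_epsP g x v (d : R) :
  (forall e, 0 < e -> exists2 dl : R, 0 < dl & forall h, h != 0 -> `|h| < dl ->
    `|h^-1 * (g (h *: v + x) - g x) - d| <= e) -> is_derive x v g d.
Proof.
move=> H.
have cv : ((fun h => h^-1 *: ((g \o shift x) (h *: v) - g x)) @ (0:R)^' --> d)%classic.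
  apply/cvgrPdistC_le => e /H[dl dl0 Hd].
  apply/nbhs_ballP; exists dl => //= h; rewrite -ball_normE /= sub0r normrN => hd h0.
  exact: Hd.
by split; [apply/cvg_ex; exists d|exact/cvg_lim].
Qed.

(** The intermediate parameter is located only by [|th| <= |h|], which avoids a case distinction on
    the sign of [h] in every application. *)
Lemma dir_MVT g (dg : V -> R) x v (h : R) :
  (forall y, is_derive y v g (dg y)) ->
  exists2 th : R, `|th| <= `|h| & g (h *: v + x) - g x = h * dg (th *: v + x).
Proof.
move=> Hg.
have Hl t : is_derive t (1 : R) (fun s : R => g (s *: v + x)) (dg (t *: v + x)).
  exact: is_derive_line.
have cl := is_derive_cont Hl.
have g0 : g x = g ((0 : R) *: v + x) by rewrite scale0r add0r.
rewrite {1}g0; have [h0|h0] := leP 0 h.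
  have [|c] := @MVT_segment R _ (fun t => dg (t *: v + x)) 0 h h0.
  - exact: continuous_subspaceT.
  rewrite in_itv /= subr0 => /andP[c0 ch] E; exists c; first by rewrite !ger0_norm.
  by rewrite E mulrC.
have [|c] := @MVT_segment R _ (fun t => dg (t *: v + x)) h 0 (ltW h0).
- exact: continuous_subspaceT.
rewrite in_itv /= sub0r => /andP[c0 ch] E; exists c.
  by rewrite !ler0_norm ?lerN2 // ltW.
by rewrite -[LHS]opprB E; ring.
Qed.

End directional_derivatives.

Section C1_functions.
Context {R : realType} {n : nat}.
Implicit Types g h : 'rV[R]_n -> R.

(** Only partial derivatives along the axes are required, so that closure properties reduce to
    one-variable calculus; Fréchet differentiability is recovered in [C1_differentiable]. *)
Definition C1 g := continuous g /\
  forall i, (forall x, derivable g x (evec R i)) /\ continuous (partial i g).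

Lemma C1_cont g : C1 g -> continuous g. Proof. by case. Qed.

Lemma C1_partial_cont g i : C1 g -> continuous (partial i g).
Proof. by case=> _ /(_ i)[]. Qed.

Lemma C1_is_derive g i x : C1 g -> is_derive x (evec R i) g (partial i g x).
Proof. by case=> _ /(_ i)[dg _]; exact: derivableP. Qed.

Lemma C1_intro g (dg : 'I_n -> 'rV[R]_n -> R) : continuous g ->
  (forall i x, is_derive x (evec R i) g (dg i x)) -> (forall i, continuous (dg i)) ->
  C1 g /\ forall i, partial i g = dg i.
Proof.
move=> cg Hg cdg.
have E i : partial i g = dg i.
  by apply/funext => x; rewrite /partial; have [_ ->] := Hg i x.
split => //; split => // i; rewrite E; split => // x; by have [] := Hg i x.
Qed.

Lemma C1D g h : C1 g -> C1 h -> C1 (fun x => g x + h x) /\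
  forall i, partial i (fun x => g x + h x) = fun x => partial i g x + partial i h x.
Proof.
move=> Cg Ch; apply: C1_intro => [|i x|i /=].
- exact: contD (C1_cont Cg) (C1_cont Ch).
- by apply: is_deriveD; exact: C1_is_derive.
- exact: contD (C1_partial_cont Cg) (C1_partial_cont Ch).
Qed.

Lemma C1M g h : C1 g -> C1 h -> C1 (fun x => g x * h x) /\
  forall i, partial i (fun x => g x * h x) =
    fun x => g x * partial i h x + h x * partial i g x.
Proof.
move=> Cg Ch; apply: C1_intro => [|i x|i /=].
- exact: contM (C1_cont Cg) (C1_cont Ch).
- by apply: is_deriveM; exact: C1_is_derive.
- exact: contD (contM (C1_cont Cg) (C1_partial_cont Ch)) (contM (C1_cont Ch) (C1_partial_cont Cg)).
Qed.

Lemma C1_cst (a : R) : C1 (fun=> a) /\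
  forall i, partial i (fun _ : 'rV[R]_n => a) = fun=> 0.
Proof.
apply: C1_intro; first exact: cont_cst.
by move=> i; exact: cont_cst.
Qed.

Lemma C1Z a g : C1 g -> C1 (fun x => a * g x) /\
  forall i, partial i (fun x => a * g x) = fun x => a * partial i g x.
Proof.
move=> Cg; have [C E] := C1M (C1_cst a).1 Cg; split=> // i.
by rewrite E (C1_cst a).2; apply/funext => x; rewrite mulr0 addr0.
Qed.

Lemma C1_comp (f df : R -> R) g : (forall s, is_derive s (1 : R) f (df s)) ->
  continuous df -> C1 g -> C1 (fun x => f (g x)) /\
  forall i, partial i (fun x => f (g x)) = fun x => df (g x) * partial i g x.
Proof.
move=> Hf cdf Cg.
have cf := is_derive_cont Hf.
apply: C1_intro => [|i x|i /=].
- exact: cont_comp (C1_cont Cg) cf.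
- by apply: is_derive_comp => //; exact: C1_is_derive.
- exact: contM (cont_comp (C1_cont Cg) cdf) (C1_partial_cont Cg).
Qed.

Lemma C1_shift g a : C1 g -> C1 (fun x => g (x + a)) /\
  forall i, partial i (fun x => g (x + a)) = fun x => partial i g (x + a).
Proof.
move=> Cg.
have ca := @cont_shift R _ a.
apply: C1_intro => [|i x|i /=].
- exact: cont_comp ca (C1_cont Cg).
- apply: is_derive_line0.
  have -> : (fun s : R => g (s *: evec R i + x + a)) =
    (fun s : R => g (s *: evec R i + (x + a))).
    by apply/funext => s; rewrite addrA.
  by apply: is_derive_line; rewrite scale0r add0r; exact: C1_is_derive.
- exact: cont_comp ca (C1_partial_cont Cg).
Qed.

Lemma norm_evec_le1 (i : 'I_n) : `|evec R i| <= 1.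
Proof.
apply: norm_le_coord => // j; rewrite mxE eqxx /=.
by case: eqP; rewrite ?normr1 ?normr0.
Qed.

Lemma partial_supp g i r : (forall x, r < `|x| -> g x = 0) ->
  forall x, r < `|x| -> partial i g x = 0.
Proof.
move=> gr x rx.
have [_ <-] : is_derive x (evec R i) g 0; last by [].
have e0 : 0 < `|x| - r by rewrite subr_gt0.
apply: is_derive_epsP => e e_gt0; exists (`|x| - r) => // h _ hd.
rewrite !gr ?subrr ?mulr0 ?subrr ?normr0 ?ltW //.
have h1 : `|h *: evec R i| <= `|h|.
  by rewrite normrZ ler_piMr // norm_evec_le1.
have := ler_normB (h *: evec R i + x) (h *: evec R i).
by rewrite [_ + x]addrC addrK; lra.
Qed.

Lemma partial_Cc g i : C1 g -> Cc g -> Cc (partial i g).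
Proof.
move=> C1g [_ [r r0 gr]]; split; first exact: C1_partial_cont.
by exists r => //; exact: partial_supp.
Qed.

(** The increment is telescoped along the axes, the mean value theorem is applied on each edge, and
    continuity of the partial derivatives controls the sum. This is needed because [smooth] demands
    differentiability at every order. *)
Lemma C1_differentiable g x : C1 g -> differentiable g x.
Proof.
move=> Cg.
pose L (h : 'rV[R]_n) := \sum_i partial i g x * h 0 i.
have Llin : linear L.
  move=> a h k; rewrite /L scaler_sumr -big_split /=; apply: eq_bigr => i _.
  by rewrite !mxE mulrDr mulrCA.
pose Lm := GRing.isLinear.Build R _ _ _ L Llin.
pose LL : {linear 'rV[R]_n -> R} := HB.pack L Lm.
have cL : continuous LL.
  apply: cont_sum => i; apply: contM; first exact: cont_cst.
  exact: coord_continuous.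
have dL : g \o shift x = cst (g x) + LL +o_ (0 : 'rV[R]_n) id.
  apply/eqaddoP => e e0.
  have e'0 : 0 < e / n.+1%:R by rewrite divr_gt0 // ltr0n.
  have Hd i : exists2 d, 0 < d & forall y, `|y - x| < d ->
      `|partial i g y - partial i g x| < e / n.+1%:R.
    have cp : continuous (partial i g) := C1_partial_cont Cg.
    by have /continuous_epsP/(_ _ e'0) := cp x.
  have [d d0 Hdd] : exists2 d, 0 < d & forall i y, `|y - x| < d ->
      `|partial i g y - partial i g x| < e / n.+1%:R.
    pose D i := projT1 (cid2 (Hd i)).
    have D0 i : 0 < D i by rewrite /D; case: cid2.
    exists (\big[Num.min/1]_i D i); first by apply/lt_bigmin.
    move=> i y yx; have : `|y - x| < D i.
      by apply: lt_le_trans yx _; exact: bigmin_le_cond.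
    by rewrite /D; case: cid2 => /= t _; exact.
  apply/nbhs_ballP; exists d => //= h; rewrite -ball_normE /= sub0r normrN => hd.
  (* [T k] keeps the first [k] coordinates of [h], so [T 0 = 0], [T n = h], and consecutive points
     differ along a single axis. *)
  pose T k := \row_j (if (j < k)%N then h 0 j else 0) : 'rV[R]_n.
  have Tn : T n = h by apply/rowP => j; rewrite mxE ltn_ord.
  have T0 : T 0%N = 0 by apply/rowP => j; rewrite !mxE.
  have TS (i : 'I_n) : T i.+1 = h 0 i *: evec R i + T i.
    apply/rowP => j; rewrite !mxE eqxx /= ltnS leq_eqVlt.
    have [->|ji] := eqVneq j i; first by rewrite ltnn eqxx mulr1 addr0.
    rewrite (_ : (j == i :> nat) = false) /=; last by apply/negbTE.
    by rewrite mulr0 add0r.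
  have tel : g (h + x) - g x = \sum_(i < n) (g (T i.+1 + x) - g (T i + x)).
    rewrite -(big_mkord xpredT (fun i => g (T i.+1 + x) - g (T i + x))).
    by rewrite telescope_sumr // Tn T0 add0r.
  have -> : (g \o shift x - (cst (g x) + LL)) h =
      \sum_(i < n) (g (T i.+1 + x) - g (T i + x) - partial i g x * h 0 i).
    by rewrite sumrB -tel /= !fctE opprD addrA.
  apply: le_trans (ler_norm_sum _ _ _) _.
  apply: (@le_trans _ _ (\sum_(i < n) e / n.+1%:R * `|h|)).
    apply: ler_sum => i _; rewrite TS -[h 0 i *: _ + _ + x]addrA.
    have [th thh ->] := @dir_MVT R _ g _ (T i + x) (evec R i) (h 0 i)
      (fun y => C1_is_derive i y Cg).
    rewrite mulrC -mulrBl normrM ler_pM // ?coord_le_norm //.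
    apply/ltW/Hdd; rewrite addrA addrK (le_lt_trans _ hd) //.
    apply: norm_le_coord => // j; rewrite !mxE eqxx /=.
    have [->|ji] := eqVneq j i.
      by rewrite ltnn mulr1 addr0 (le_trans thh) // coord_le_norm.
    by rewrite mulr0 add0r; case: ifP => _; rewrite ?normr0 // coord_le_norm.
  rewrite sumr_const card_ord -[_ *+ n]mulr_natr mulrAC ler_wpM2r //.
  by rewrite mulrAC ler_pdivrMr ?ltr0n // ler_pM2l // ler_nat.
have E := diff_unique cL dL.
by apply/diff_locallyP; rewrite E.
Qed.

End C1_functions.

(** * Convolutions and integration by parts *)

Section convolution.
Context {R : realType} {n : nat}.
Implicit Types g h z : 'rV[R]_n -> R.
Local Notation I := (@integral_Rn R n).

Lemma int_mul_bound (phi z : 'rV[R]_n -> R) (r w M : R) : 0 <= r -> 0 <= w -> continuous phi ->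
  continuous z -> (forall x, r < `|x| -> z x = 0) -> (forall x, `|z x| <= M) ->
  (forall x, `|x| <= r -> `|phi x| <= w) ->
  `|I (fun x => phi x * z x)| <= w * M * (2 * r) ^+ n.
Proof.
move=> r0 w0 cphi cz zr zM phiw; apply: int_bound => //.
- exact: contM.
- by move=> x rx; rewrite zr // mulr0.
- move=> x; have [xr|rx] := leP `|x| r; last first.
    by rewrite zr // mulr0 normr0 mulr_ge0 // (le_trans _ (zM x)).
  by rewrite normrM ler_pM // phiw.
Qed.

(** With [s = -1] this is convolution, with [s = 1] correlation. In both cases the variable [x]
    occurs only in the first factor, so all derivatives fall on [g] and [z] need only be
    continuous. *)
Definition conv (s : R) g z := fun x => I (fun y => g (x + s *: y) * z y).

Lemma conv_integrand_Cc s g z x : continuous g -> Cc z -> Cc (fun y => g (x + s *: y) * z y).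
Proof. by move=> cg; apply: CcMl; exact: cont_comp (@cont_affine R _ x s) cg. Qed.

Lemma Cc_bounded z : Cc z -> exists2 M, 0 <= M & forall x, `|z x| <= M.
Proof.
move=> [cz [r r0 zr]]; have [M M0 HM] := continuous_bounded_rV r cz.
exists M => // x; have [xr|rx] := leP `|x| r; first exact: HM.
by rewrite zr // normr0.
Qed.

Lemma norm_affine_le (s r : R) (x y : 'rV[R]_n) : `|y| <= r -> `|x + s *: y| <= `|x| + `|s| * r.
Proof.
move=> yr; apply: le_trans (ler_normD _ _) _; rewrite lerD2l normrZ.
by rewrite ler_wpM2l.
Qed.

Lemma conv_cont s g z : continuous g -> Cc z -> continuous (conv s g z).
Proof.
move=> cg Cz x; apply/continuous_epsP => e e0.
have [M M0 zM] := Cc_bounded Cz; have [cz [r r0 zr]] := Cz.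
pose P := M * (2 * r) ^+ n + 1.
have P0 : 0 < P by rewrite ltr_wpDl // mulr_ge0 // exprn_ge0 // mulr_ge0.
have eP0 : 0 < e / P by rewrite divr_gt0.
have [d d0 H] := continuous_unif_rV (`|x| + `|s| * r) cg eP0.
exists d => // y yx.
rewrite /conv -intB; try exact: conv_integrand_Cc.
under [fun _ => _]funext do rewrite -mulrBl.
apply: (@le_lt_trans _ _ (e / P * M * (2 * r) ^+ n)).
  apply: int_mul_bound => //; first exact: ltW.
    by apply: contB; [exact: cont_comp (@cont_affine R _ y s) cg|
      exact: cont_comp (@cont_affine R _ x s) cg].
  move=> w wr; apply/ltW/H; first exact: norm_affine_le.
  by rewrite opprD addrACA subrr addr0.
rewrite -mulrA mulrAC ltr_pdivrMr // ltr_pM2l // /P; lra.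
Qed.

(** Differentiation under the integral: by the mean value theorem the difference quotient of [g] is
    a value of [dg] at a nearby point, uniformly over the support of [z]. *)
Lemma conv_is_derive s g (dg : 'rV[R]_n -> R) z v x : continuous g ->
  (forall y, is_derive y v g (dg y)) -> continuous dg -> Cc z ->
  is_derive x v (conv s g z) (conv s dg z x).
Proof.
move=> cg Hg cdg Cz; apply: is_derive_epsP => e e0.
have [M M0 zM] := Cc_bounded Cz; have [cz [r r0 zr]] := Cz.
pose P := M * (2 * r) ^+ n + 1.
have P0 : 0 < P by rewrite ltr_wpDl // mulr_ge0 // exprn_ge0 // mulr_ge0.
have eP0 : 0 < e / P by rewrite divr_gt0.
have [d d0 H] := continuous_unif_rV (`|x| + `|s| * r) cdg eP0.
have v0 : 0 < `|v| + 1 by rewrite ltr_wpDl.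
exists (d / (`|v| + 1)); first by rewrite divr_gt0.
move=> h h0 hd.
pose phi y := h^-1 * (g (h *: v + x + s *: y) - g (x + s *: y)) - dg (x + s *: y).
have ca (a : 'rV[R]_n) : continuous (fun y : 'rV[R]_n => g (a + s *: y)).
  exact: cont_comp (@cont_affine R _ a s) cg.
have cda : continuous (fun y : 'rV[R]_n => dg (x + s *: y)).
  exact: cont_comp (@cont_affine R _ x s) cdg.
have -> : h^-1 * (conv s g z (h *: v + x) - conv s g z x) - conv s dg z x =
    I (fun y => phi y * z y).
  rewrite /conv -intB; try exact: conv_integrand_Cc.
  rewrite -intZ; last by apply: CcB; exact: conv_integrand_Cc.
  rewrite -intB; [|by apply/CcZ/CcB; exact: conv_integrand_Cc|exact: conv_integrand_Cc].
  by congr I; apply/funext => y; rewrite /phi; ring.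
apply: (@le_trans _ _ (e / P * M * (2 * r) ^+ n)).
  apply: int_mul_bound => //; first exact: ltW.
    by apply: contB => //; apply: contM; [exact: cont_cst|exact: contB].
  move=> y yr; rewrite /phi -addrA.
  have [th thh ->] := @dir_MVT R _ g dg (x + s *: y) v h Hg.
  rewrite mulKf //; apply/ltW/H; first exact: norm_affine_le.
  rewrite addrK normrZ (@le_lt_trans _ _ (`|h| * (`|v| + 1))) //; last first.
    by rewrite -ltr_pdivlMr.
  by rewrite ler_pM // lerDl.
rewrite -mulrA mulrAC ler_pdivrMr // ler_pM2l // /P; lra.
Qed.

Lemma conv_C1 s g z : C1 g -> Cc z -> C1 (conv s g z) /\
  forall i, partial i (conv s g z) = conv s (partial i g) z.
Proof.
move=> Cg Cz; apply: C1_intro => [|i x|i].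
- exact: conv_cont (C1_cont Cg) Cz.
- apply: conv_is_derive => //; first exact: C1_cont.
    by move=> y; exact: C1_is_derive.
  exact: C1_partial_cont.
- exact: conv_cont (C1_partial_cont Cg) Cz.
Qed.

(** A merely continuous cutoff suffices, because it serves as the factor of [conv] that is not
    differentiated. *)
Lemma cutoff_exists (r : R) :
  exists2 z : 'rV[R]_n -> R, Cc z & forall x, `|x| <= r -> z x = 1.
Proof.
pose p (t : R) := (t + `|t|) / 2.
have p_pos t : 0 <= t -> p t = t by move=> t0; rewrite /p ger0_norm //; lra.
have p_neg t : t <= 0 -> p t = 0 by move=> t0; rewrite /p ler0_norm //; lra.
have cp : continuous p.
  apply: contM; last exact: cont_cst.
  apply: contD; first by move=> t; exact: cvg_id.
  by move=> t; exact: (@norm_continuous R R^o t).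
exists (fun x => p (1 - p (`|x| - r))); last first.
  by move=> x xr; rewrite (p_neg (`|x| - r)) ?subr0 ?p_pos //; lra.
split.
  apply: (cont_comp _ cp); apply: contB; first exact: cont_cst.
  apply: (cont_comp _ cp); apply: contB; last exact: cont_cst.
  exact: norm_continuous.
exists (`|r| + 1); first by rewrite addr_ge0.
move=> x rx; have := ler_norm r => rr.
by rewrite (p_pos (`|x| - r)) ?p_neg //; lra.
Qed.

(** The integral of [g (y + t e_i)] does not depend on [t] by translation invariance, while its
    derivative at [t = 0] is the integral of the partial derivative. The cutoff, equal to 1 on a
    ball one unit larger than the support, expresses both through [conv] for [|t| <= 1]. *)
Lemma int_partial i g : C1 g -> Cc g -> I (partial i g) = 0.
Proof.
move=> C1g Cg; have [cg [r r0 gr]] := Cg.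
have [z Cz z1] := cutoff_exists (r + 1).
have Hd : is_derive (0 : 'rV[R]_n) (evec R i) (conv 1 g z) (conv 1 (partial i g) z 0).
  apply: conv_is_derive => //; last exact: C1_partial_cont.
  by move=> y; exact: C1_is_derive.
have E : conv 1 (partial i g) z 0 = I (partial i g).
  congr I; apply/funext => y; rewrite add0r scale1r.
  have [yr|ry] := leP `|y| (r + 1); first by rewrite z1 ?mulr1.
  by rewrite (partial_supp i gr) ?mul0r //; lra.
rewrite -E; have [_ <-] := Hd.
have [_ <-] : is_derive (0 : 'rV[R]_n) (evec R i) (conv 1 g z) 0; last by [].
have conv_const (t : R) : `|t| <= 1 -> conv 1 g z (t *: evec R i) = I g.
  move=> h1; rewrite -[RHS](int_shift (t *: evec R i) Cg).
  congr I; apply/funext => y; rewrite scale1r addrC.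
  have [yr|ry] := leP `|y| (r + 1); first by rewrite z1 ?mulr1.
  rewrite gr ?mul0r //.
  have : `|t *: evec R i| <= 1.
    by rewrite normrZ (le_trans _ h1) // ler_piMr // norm_evec_le1.
  by have := ler_normB (y + t *: evec R i) (t *: evec R i); rewrite addrK; lra.
apply: is_derive_epsP => e e0; exists 1 => // h _ h1.
have := conv_const 0; rewrite scale0r normr0 => -> //.
by rewrite addr0 conv_const ?subrr ?mulr0 ?subrr ?normr0; exact: ltW.
Qed.

Lemma int_by_parts i g h : C1 g -> C1 h -> Cc g ->
  I (fun x => partial i g x * h x) = - I (fun x => g x * partial i h x).
Proof.
move=> C1g C1h Cg.
have [C1gh E] := C1M C1g C1h.
have := int_partial i C1gh (CcMr Cg (C1_cont C1h)).
rewrite E intD; first last.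
- exact: CcMl (C1_cont C1h) (partial_Cc i C1g Cg).
- exact: CcMr Cg (C1_partial_cont C1h).
move=> /eqP; rewrite addrC addr_eq0 => /eqP <-.
by congr I; apply/funext => x; rewrite mulrC.
Qed.

End convolution.

Opaque partial.

(** * Weak formulations of the equation *)

Section second_order.
Context {R : realType} {n : nat}.
Implicit Types u g h z : 'rV[R]_n -> R.
Local Notation I := (@integral_Rn R n).

Definition C2 u := C1 u /\ forall i, C1 (partial i u).

Lemma Ck2_C2 u : Ck 2 u -> C2 u.
Proof.
have Ck1 g : Ck 1 g -> C1 g.
  move=> [cg [dg cpg]]; split=> // i; split; last by have [] := cpg i.
  by move=> x; exact: diff_derivable.
move=> [cu [du Cpu]]; split; last by move=> i; exact: Ck1.
apply: Ck1; split => //; split => // i; have [? ?] := Cpu i; by split.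
Qed.

Lemma second_difference u i j x (s t : R) : C2 u ->
  exists2 p : 'rV[R]_n, `|p - x| <= `|s| + `|t| &
    u (s *: evec R i + (t *: evec R j + x)) - u (s *: evec R i + x)
      - (u (t *: evec R j + x) - u x) = s * (t * partial j (partial i u) p).
Proof.
move=> [C1u C1pu].
pose phi y := u (t *: evec R j + y) - u y.
have dphi y : is_derive y (evec R i) phi
    (partial i u (t *: evec R j + y) - partial i u y).
  apply: is_deriveB; last exact: C1_is_derive.
  have [C E] := C1_shift (t *: evec R j) C1u.
  have -> : (fun y => u (t *: evec R j + y)) = (fun y => u (y + t *: evec R j)).
    by apply/funext => y'; rewrite addrC.
  by rewrite addrC -(congr1 (@^~ y) (E i)); exact: C1_is_derive.
have [th ths E1] := dir_MVT x s dphi.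
have [th' tht E2] := @dir_MVT R _ (partial i u) _ (th *: evec R i + x) (evec R j) t
   (fun y => C1_is_derive j y (C1pu i)).
exists (th' *: evec R j + (th *: evec R i + x)); last first.
  by rewrite -E2 -E1 /phi; congr (u _ - _ - _); rewrite addrCA.
rewrite addrA addrK addrC (le_trans (ler_normD _ _)) // !normrZ.
by rewrite lerD // (le_trans _ ths, le_trans _ tht) // ler_piMr // norm_evec_le1.
Qed.

(** Schwarz's theorem. The second difference is symmetric in the two directions, so the two mixed
    derivatives coincide at suitable points [p] and [q] near [x]; continuity then moves both to
    [x]. *)
Lemma partialC u i j x : C2 u -> partial i (partial j u) x = partial j (partial i u) x.
Proof.
move=> C2u; have [C1u C1pu] := C2u.
apply/eqP; rewrite -subr_eq0 -normr_le0; apply/ler_addgt0Pr => e e0; rewrite add0r.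
have e20 : 0 < e / 2 by rewrite divr_gt0.
have cij : continuous (partial i (partial j u)) := C1_partial_cont (C1pu j).
have cji : continuous (partial j (partial i u)) := C1_partial_cont (C1pu i).
have /continuous_epsP/(_ _ e20)[d1 d10 H1] := cij x.
have /continuous_epsP/(_ _ e20)[d2 d20 H2] := cji x.
have [t t0 [td1 td2]] : exists2 t : R, 0 < t & `|t| + `|t| < d1 /\ `|t| + `|t| < d2.
  have [m m0 [m1 m2]] : exists2 m : R, 0 < m & m <= d1 /\ m <= d2.
    by exists (Num.min d1 d2); rewrite ?lt_min ?d10 // !ge_min !lexx orbT.
  have t0 : 0 < m / 4 by rewrite divr_gt0.
  by exists (m / 4) => //; rewrite gtr0_norm //; split; clear -m0 m1 m2; lra.
have [p px Ep] := second_difference i j x t t C2u.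
have [q qx Eq] := second_difference j i x t t C2u.
have sym (a b : 'rV[R]_n) : u (a + (b + x)) - u (a + x) - (u (b + x) - u x) =
    u (b + (a + x)) - u (b + x) - (u (a + x) - u x).
  rewrite addrCA; move: (u _) (u _) (u _) (u _) => A B C D; ring.
have Epq : partial j (partial i u) p = partial i (partial j u) q.
  apply: (mulfI (lt0r_neq0 t0)); apply: (mulfI (lt0r_neq0 t0)).
  exact: (etrans (esym Ep) (etrans (sym _ _) Eq)).
have := H1 _ (le_lt_trans qx td1); have := H2 _ (le_lt_trans px td2); rewrite Epq.
move: (partial i (partial j u) x) (partial j (partial i u) x)
  (partial i (partial j u) q) => a b c; clear.
by rewrite !ltr_norml ler_norml => /andP[? ?] /andP[? ?]; apply/andP; split; lra.
Qed.

Definition gradM g h x := \sum_(i < n) partial i g x * partial i h x.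

Lemma gradM_cont g h : C1 g -> C1 h -> continuous (gradM g h).
Proof.
by move=> Cg Ch; apply: cont_sum => i; apply: contM; apply: C1_partial_cont.
Qed.

Lemma gradM_Cc g h : C1 g -> C1 h -> Cc h -> Cc (gradM g h).
Proof.
move=> C1g C1h Ch; apply: Cc_sum => i.
by apply: CcMl; [exact: C1_partial_cont|exact: partial_Cc].
Qed.

Lemma grad_sqE g : grad_sq g = gradM g g.
Proof. by apply/funext => x; apply: eq_bigr => i _; rewrite expr2. Qed.

Lemma Green g z : C2 g -> C1 z -> Cc z ->
  I (gradM g z) = - I (fun x => laplacian g x * z x).
Proof.
move=> [C1g C1pg] C1z Cz; rewrite /gradM int_sum; last first.
  by move=> i; apply: CcMl; [exact: C1_partial_cont|exact: partial_Cc].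
have -> : (fun x => laplacian g x * z x) =
    (fun x => \sum_(i < n) z x * partial i (partial i g) x).
  by apply/funext => x; rewrite /laplacian mulr_suml; apply: eq_bigr => i _; rewrite mulrC.
rewrite int_sum; last first.
  by move=> i; apply: CcMr => //; exact: C1_partial_cont.
rewrite -sumrN; apply: eq_bigr => i _; rewrite -int_by_parts //.
by congr I; apply/funext => x; rewrite mulrC.
Qed.

End second_order.

(** * Weak equation, linearized equation and energy inequalities *)

Section semilinear_equation.
Context {R : realType} {n : nat}.
Variables (f : R -> R) (u : 'rV[R]_n -> R).
Hypotheses (Cf : C1R f) (Cu : C2 u).
Hypothesis eqn : forall x, laplacian u x + f (u x) = 0.
Implicit Types z : 'rV[R]_n -> R.
Local Notation I := (@integral_Rn R n).

Lemma C1R_is_derive s : is_derive s (1 : R) f (f^`()%classic s).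
Proof. by rewrite derive1E; apply: derivableP; case: Cf. Qed.

Lemma C1R_cont : continuous f. Proof. exact: is_derive_cont C1R_is_derive. Qed.

Lemma C2_shift a : C2 (fun x => u (x + a)) /\
  forall i, partial i (fun x => u (x + a)) = (fun x => partial i u (x + a)).
Proof.
have [C1u C1pu] := Cu; have [C1a E] := C1_shift a C1u.
split; last exact: E.
split; first exact: C1a.
by move=> i; rewrite (E i); exact: (C1_shift a (C1pu i)).1.
Qed.

(** The translation [a] is the variable in which [weak_linearized] differentiates. *)
Lemma weak_eqn z a : C1 z -> Cc z ->
  I (gradM (fun x => u (x + a)) z) = I (fun x => f (u (x + a)) * z x).
Proof.
move=> C1z Cz; have [Ca Ea] := C2_shift a.
rewrite Green // -intN; last first.
  apply: CcMl => //; apply: cont_sum => i.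
  by have [_ /(_ i)C1p] := Ca; exact: C1_partial_cont.
congr I; apply/funext => x; rewrite -mulNr; congr (_ * _).
suff -> : laplacian (fun x => u (x + a)) x = laplacian u (x + a).
  by apply/eqP; rewrite eq_sym -addr_eq0 addrC eqn.
apply: eq_bigr => i _; rewrite Ea.
by have [_ /(_ i)->] := C1_shift a (Cu.2 i).
Qed.

(** Third derivatives of [u] need not exist, so the equation itself cannot be differentiated.
    Instead both sides of the weak equation are [conv] integrals in the translation [a];
    differentiating them at [a = 0] along [e_i] and exchanging mixed derivatives gives the claim. *)
Lemma weak_linearized i z : C1 z -> Cc z ->
  I (gradM (partial i u) z) = I (fun x => f^`()%classic (u x) * partial i u x * z x).
Proof.
move=> C1z Cz; have [C1u C1pu] := Cu.
have [C1fu Efu] := C1_comp C1R_is_derive Cf.2 C1u.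
have E : (fun x => \sum_(j < n) conv 1 (partial j u) (partial j z) x) =
    conv 1 (fun x => f (u x)) z.
  apply/funext => a; rewrite /conv -int_sum; last first.
    by move=> j; apply: conv_integrand_Cc;[exact: C1_partial_cont|exact: partial_Cc].
  have [_ Ea] := C2_shift a.
  transitivity (I (gradM (fun x => u (x + a)) z)).
    congr I; apply/funext => x; apply: eq_bigr => j _.
    by rewrite Ea scale1r addrC.
  by rewrite weak_eqn //; congr I; apply/funext => x; rewrite scale1r addrC.
have D1 : is_derive (0 : 'rV[R]_n) (evec R i)
    (fun x => \sum_(j < n) conv 1 (partial j u) (partial j z) x)
    (\sum_(j < n) conv 1 (partial i (partial j u)) (partial j z) 0).
  have -> : (fun x => \sum_(j < n) conv 1 (partial j u) (partial j z) x) =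
     \sum_(j < n) conv 1 (partial j u) (partial j z).
    by apply/funext => x; rewrite fct_sumE.
  apply: is_derive_sum => j.
  have [C Ej] := conv_C1 1 (C1pu j) (partial_Cc j C1z Cz).
  by rewrite -Ej; exact: C1_is_derive.
have D2 : is_derive (0 : 'rV[R]_n) (evec R i) (conv 1 (fun x => f (u x)) z)
    (conv 1 (fun x => f^`()%classic (u x) * partial i u x) z 0).
  have [C Ej] := conv_C1 1 C1fu Cz.
  by rewrite -Efu -Ej; exact: C1_is_derive.
rewrite E in D1; have [_ V1] := D1; have [_ V2] := D2; rewrite V2 in V1.
have -> : I (fun x => f^`()%classic (u x) * partial i u x * z x) =
   conv 1 (fun x => f^`()%classic (u x) * partial i u x) z 0.
  by congr I; apply/funext => x; rewrite add0r scale1r.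
rewrite V1 /conv -int_sum; last first.
  move=> j; apply: conv_integrand_Cc; last exact: partial_Cc.
  exact: C1_partial_cont.
have pw x : gradM (partial i u) z x =
    \sum_(j < n) partial i (partial j u) (0 + 1 *: x) * partial j z x.
  by apply: eq_bigr => j _; rewrite add0r scale1r (partialC i j x Cu).
by rewrite (funext pw).
Qed.

(** Testing with [u z^2], the right-hand side is nonpositive since the sign condition holds wherever
    [z] is nonzero. The cross term is absorbed by the square of [a z + 2 u b], with [a], [b] the
    partial derivatives of [u], [z]; what remains has coefficients [1/2] and [2], whose quotient is
    4. *)
Lemma Caccioppoli z : C1 z -> Cc z -> (forall x, z x != 0 -> f (u x) * u x <= 0) ->
  I (fun x => grad_sq u x * z x ^+ 2) <= 4 * I (fun x => u x ^+ 2 * grad_sq z x).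
Proof.
move=> C1z Cz fu0; have [C1u _] := Cu.
have [C1zz Ezz] := C1M C1z C1z.
have [C1psi Epsi] := C1M C1u C1zz.
have Czz : Cc (fun x => z x * z x) by exact: CcMr Cz (C1_cont C1z).
have Cpsi : Cc (fun x => u x * (z x * z x)) by exact: CcMl (C1_cont C1u) Czz.
have CA : Cc (fun x => grad_sq u x * z x ^+ 2).
  rewrite grad_sqE; under [fun _ => _]funext do rewrite expr2.
  by apply: CcMl => //; exact: gradM_cont.
have CB : Cc (fun x => u x ^+ 2 * grad_sq z x).
  rewrite grad_sqE; apply: CcMl; last exact: gradM_Cc.
  by apply: contX; exact: C1_cont.
have W := weak_eqn 0 C1psi Cpsi.
have u0 : (fun x => u (x + 0)) = u by apply/funext => x; rewrite addr0.
rewrite u0 in W.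
have W0 : I (fun x => f (u (x + 0)) * (u x * (z x * z x))) <= 0.
  rewrite -oppr_ge0 -intN; last first.
    by apply: CcMl => //; apply: (cont_comp _ C1R_cont); rewrite u0; exact: C1_cont.
  apply: int_ge0.
    apply: CcN; apply: CcMl => //; apply: (cont_comp _ C1R_cont).
    by rewrite u0; exact: C1_cont.
  move=> x; rewrite addr0; have [->|zx] := eqVneq (z x) 0; first by rewrite !mulr0 oppr0.
  by rewrite mulrA -mulNr mulr_ge0 ?oppr_ge0 ?fu0 // -expr2 sqr_ge0.
have H : I (fun x => 2^-1 * (grad_sq u x * z x ^+ 2) - 2 * (u x ^+ 2 * grad_sq z x)) <=
    I (gradM u (fun x => u x * (z x * z x))).
  apply: int_le; first by apply: CcB; exact: CcZ.
    exact: gradM_Cc.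
  move=> x; rewrite /gradM /grad_sq mulr_suml !mulr_sumr -sumrB.
  apply: ler_sum => i _; rewrite Epsi Ezz -subr_ge0.
  set a := partial i u x; set b := partial i z x.
  have -> : a * (u x * (z x * b + z x * b) + z x * z x * a) -
      (2^-1 * (a ^+ 2 * z x ^+ 2) - 2 * (u x ^+ 2 * b ^+ 2)) =
      2^-1 * (a * z x + 2 * (u x * b)) ^+ 2 by field.
  by rewrite mulr_ge0 // sqr_ge0.
rewrite intB ?intZ // in H; try exact: CcZ.
lra.
Qed.

(** The quadratic form of the operator [- Lap - c]; for [c = f'(u)] stability says that it is
    nonnegative on test functions. *)
Definition Qform (c a : 'rV[R]_n -> R) := I (fun x => grad_sq a x - c x * a x ^+ 2).

Lemma Qform_Cc (c a : 'rV[R]_n -> R) : continuous c -> C1 a -> Cc a ->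
  Cc (fun x => grad_sq a x - c x * a x ^+ 2).
Proof.
move=> cc C1a Ca; apply: CcB; first by rewrite grad_sqE; exact: gradM_Cc.
under [fun _ => _]funext do rewrite expr2.
by apply: CcMl => //; apply: CcMl => //; exact: C1_cont.
Qed.

(** Here [G] is a smoothed positive part, and the linearized equation is tested with [eta^2 H(w)].
    The choice [H = G G'] makes the cross terms of [|grad (eta G(w))|^2] match; [G'^2 <= H'] amounts
    to [G G'' >= 0], so the terms in [|grad w|^2] have the good sign. The exact positive part would
    satisfy [s H = G^2]; the defect of this identity is what the term with [e] pays for. *)
Lemma truncated_energy i (G G' H H' : R -> R) (e : R) (eta : 'rV[R]_n -> R) :
  (forall s, is_derive s (1 : R) G (G' s)) -> continuous G' ->
  (forall s, is_derive s (1 : R) H (H' s)) -> continuous H' ->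
  (forall s, H s = G s * G' s) -> (forall s, G' s ^+ 2 <= H' s) ->
  (forall s, G s ^+ 2 <= s ^+ 2) -> (forall s, `|s * H s - G s ^+ 2| <= e * `|s|) ->
  C1 eta -> Cc eta ->
  Qform (fun x => f^`()%classic (u x)) (fun x => eta x * G (partial i u x)) <=
  I (fun x => partial i u x ^+ 2 * grad_sq eta x) +
  e * I (fun x => `|f^`()%classic (u x)| * eta x ^+ 2 * `|partial i u x|).
Proof.
move=> dG cG' dH cH' HE H'ge Gle Hle C1eta Ceta.
set w := partial i u; set c := fun x => f^`()%classic (u x).
have C1w : C1 w by exact: Cu.2.
have cc : continuous c by apply: (cont_comp _ Cf.2); exact: C1_cont Cu.1.
have [C1G EG] := C1_comp dG cG' C1w.
have [C1H EH] := C1_comp dH cH' C1w.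
have [C1a Ea] := C1M C1eta C1G.
have [C1ee Eee] := C1M C1eta C1eta.
have [C1z Ez] := C1M C1ee C1H.
have Ca : Cc (fun x => eta x * G (w x)) by exact: CcMr Ceta (C1_cont C1G).
have Cee : Cc (fun x => eta x * eta x) by exact: CcMr Ceta (C1_cont C1eta).
have Cz : Cc (fun x => eta x * eta x * H (w x)) by exact: CcMr Cee (C1_cont C1H).
have W := weak_linearized i C1z Cz; rewrite -/w in W.
have CW1 : Cc (gradM w (fun x => eta x * eta x * H (w x))) by exact: gradM_Cc.
have CW2 : Cc (fun x => c x * w x * (eta x * eta x * H (w x))).
  by apply: CcMl => //; apply: contM => //; exact: C1_cont C1w.
have CA : Cc (fun x => w x ^+ 2 * grad_sq eta x).
  rewrite grad_sqE; apply: CcMl; last exact: gradM_Cc.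
  by apply: contX; exact: C1_cont.
have CB : Cc (fun x => `|c x| * eta x ^+ 2 * `|w x|).
  apply: CcMr; last first.
    apply: (cont_comp (C1_cont C1w)) => t; exact: (@norm_continuous R R^o t).
  under [fun _ => _]funext do rewrite expr2.
  by apply: CcMl => //; apply: (cont_comp cc) => t; exact: (@norm_continuous R R^o t).
have -> : I (fun x => w x ^+ 2 * grad_sq eta x) + e * I (fun x => `|c x| * eta x ^+ 2 * `|w x|)
  = I (fun x => (gradM w (fun x => eta x * eta x * H (w x)) x -
        c x * w x * (eta x * eta x * H (w x))) +
     (w x ^+ 2 * grad_sq eta x + e * (`|c x| * eta x ^+ 2 * `|w x|))).
  rewrite intD; [|exact: CcB|by apply: CcD => //; exact: CcZ].
  rewrite intB // W subrr add0r intD //; last exact: CcZ.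
  by rewrite intZ.
apply: int_le; first exact: Qform_Cc.
  by apply: CcD; [exact: CcB|apply: CcD => //; exact: CcZ].
move=> x.
have Hgrad : grad_sq (fun x => eta x * G (w x)) x <=
   gradM w (fun x => eta x * eta x * H (w x)) x + w x ^+ 2 * grad_sq eta x.
  rewrite /grad_sq /gradM mulr_sumr -big_split /=; apply: ler_sum => j _.
  rewrite Ea Ez Eee EG EH HE.
  set a := partial j w x; set b := partial j eta x.
  rewrite -subr_ge0.
  have -> : a * (eta x * eta x * (H' (w x) * a) + G (w x) * G' (w x) * (eta x * b + eta x * b)) +
    w x ^+ 2 * b ^+ 2 - (eta x * (G' (w x) * a) + G (w x) * b) ^+ 2 =
    (eta x * a) ^+ 2 * (H' (w x) - G' (w x) ^+ 2) + b ^+ 2 * (w x ^+ 2 - G (w x) ^+ 2) by ring.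
  by rewrite addr_ge0 // mulr_ge0 ?sqr_ge0 // subr_ge0.
have Hc : c x * w x * (eta x * eta x * H (w x)) - c x * (eta x * G (w x)) ^+ 2 <=
    e * (`|c x| * eta x ^+ 2 * `|w x|).
  have -> : c x * w x * (eta x * eta x * H (w x)) - c x * (eta x * G (w x)) ^+ 2 =
    c x * eta x ^+ 2 * (w x * H (w x) - G (w x) ^+ 2) by ring.
  apply: le_trans (ler_norm _) _; rewrite normrM
    [`|c x * _|]normrM [`|eta x ^+ 2|]ger0_norm ?sqr_ge0 //.
  have -> : e * (`|c x| * eta x ^+ 2 * `|w x|) = `|c x| * eta x ^+ 2 * (e * `|w x|) by ring.
  by rewrite ler_wpM2l // mulr_ge0 // sqr_ge0.
lra.
Qed.

End semilinear_equation.

Lemma scaleRE {R : realType} (a b : R) : a *: b = a * b. Proof. by []. Qed.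

Lemma is_derive_pow {R : realType} {V : normedModType R} (f : V -> R) x v (df : R) k :
  is_derive x v f df -> is_derive x v (fun y => f y ^+ k) (k%:R * f x ^+ k.-1 * df).
Proof.
move=> Hf; elim: k => [|k IH].
  by rewrite mul0r mul0r; exact: (is_derive_cst (1 : R) x v).
have -> : (fun y => f y ^+ k.+1) = f * (fun y => f y ^+ k).
  by apply/funext => y; rewrite exprS.
apply: (is_derive_eq (is_deriveM Hf IH)); rewrite !scaleRE /= -natr1.
by case: k {IH} => [|k] /=; rewrite ?expr0 ?exprS; ring.
Qed.

Lemma is_derive_invX {R : realType} k (q : R) : q != 0 ->
  is_derive q (1 : R) (fun t : R => t^-1 ^+ k) (- (k%:R * q^-1 ^+ k.+1)).
Proof.
move=> q0; have q_neq0 : id q != 0 :> R by [].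
have dinv : is_derive q (1 : R) (fun t : R => t^-1) (- (q^-1 ^+ 2)).
  by apply: (is_derive_eq (is_deriveV q_neq0 (is_derive_id q (1 : R))));
    rewrite [_ *: _]mulr1 -exprVn.
apply: (is_derive_eq (is_derive_pow k dinv)).
by case: k => [|k] /=; rewrite ?expr0 ?exprS; ring.
Qed.

Lemma is_derive_addr {R : realType} (a t : R) : is_derive t (1 : R) (fun s : R => s + a) 1.
Proof.
apply: (is_derive_eq (is_deriveD (is_derive_id t (1 : R)) (is_derive_cst a t (1 : R)))).
by rewrite addr0.
Qed.

(** * Density of smooth test functions *)

Section smooth_bump.
Context {R : realType}.

(** The exponent [k] makes the family closed under differentiation up to linear combinations, which
    is how smoothness of the bump [expinv 0] is obtained. *)
Definition expinv (k : nat) (q : R) : R :=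
  if 0 < q then q^-1 ^+ k * expR (- q^-1) else 0.

Lemma expinv_ge0 k q : 0 <= expinv k q.
Proof.
rewrite /expinv; case: ifP => // q0.
by rewrite mulr_ge0 ?expR_ge0 // exprn_ge0 // invr_ge0 ltW.
Qed.

Lemma expinv_gt0 q : 0 < q -> 0 < expinv 0 q.
Proof. by rewrite /expinv => ->; rewrite expr0 mul1r expR_gt0. Qed.

Lemma expinv_le0 k q : q <= 0 -> expinv k q = 0.
Proof. by rewrite /expinv ltNge => ->. Qed.

(** One term of the exponential series at [1/q], of order [k + 2], beats [q^-k] with two powers to
    spare; quadratic decay then gives a vanishing derivative at 0. *)
Lemma expinv_quadratic k q : expinv k q <= k.+2`!%:R * q ^+ 2.
Proof.
rewrite /expinv; case: ifP => [q0|_]; last by rewrite mulr_ge0 // sqr_ge0.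
have i0 : 0 < q^-1 by rewrite invr_gt0.
have F0 : 0 < (k.+2`!%:R : R) by rewrite ltr0n fact_gt0.
have := expR_ge1Dxn k.+1 (ltW i0) => H.
have H1 : q^-1 ^+ k.+2 / k.+2`!%:R <= expR q^-1 by lra.
rewrite expRN ler_pdivrMr ?expR_gt0 //.
apply: le_trans (ler_wpM2l _ H1); last by rewrite mulr_ge0 ?sqr_ge0 // ltW.
rewrite !exprS !mulrA le_eqVlt; apply/orP; left; apply/eqP.
rewrite expr0; field.
by rewrite !gt_eqF.
Qed.

Lemma is_derive_expinv k q :
  is_derive q (1 : R) (expinv k) (expinv k.+2 q - k%:R * expinv k.+1 q).
Proof.
have [q0|q0|->] := ltgtP q 0.
- rewrite !expinv_le0 ?ltW // mulr0 subr0.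
  apply: (@near_eq_is_derive _ _ _ (cst 0)).
  near=> t; rewrite expinv_le0 // ltW //; near: t; exact: lt_nbhsl.
- have qn : q != 0 by rewrite gt_eqF.
  have dpow := is_derive_invX k qn.
  have dinv : is_derive q (1 : R) (fun t : R => t^-1) (- (q^-1 ^+ 2)).
    by have := is_derive_invX 1 qn; rewrite mul1r.
  have dexp : is_derive q (1 : R) (fun t : R => expR (- t^-1)) (expR (- q^-1) * q^-1 ^+ 2).
    apply: (@is_derive1_comp _ expR (fun t => - t^-1)); apply: is_derive_eq.
    by rewrite opprK.
  have dprod : is_derive q (1 : R) (fun t : R => t^-1 ^+ k * expR (- t^-1))
      (expinv k.+2 q - k%:R * expinv k.+1 q).
    apply: (is_derive_eq (is_deriveM dpow dexp)).
    rewrite /expinv q0 !scaleRE /= !exprS; ring.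
  apply: near_eq_is_derive dprod.
  near=> t; rewrite /expinv ifT //; near: t; exact: lt_nbhsr.
- rewrite !expinv_le0 // mulr0 subr0; apply: is_derive_epsP => e e0.
  have F0 : 0 < (k.+2`!%:R : R) by rewrite ltr0n fact_gt0.
  exists (e / k.+2`!%:R); first by rewrite divr_gt0.
  move=> h h0 hd; rewrite [h *: 1]mulr1 addr0 (@expinv_le0 _ 0) // !subr0.
  rewrite normrM normfV ler_pdivrMl ?normr_gt0 // ger0_norm ?expinv_ge0 //.
  apply: le_trans (expinv_quadratic k h) _.
  rewrite -[h ^+ 2]real_normK ?num_real // expr2 mulrCA ler_wpM2l //.
  by rewrite mulrC -ler_pdivlMr // ltW.
Unshelve. all: by end_near.
Qed.

End smooth_bump.

(** * Radial functions and a class of smooth bumps *)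

Section radial.
Context {R : realType} {n : nat}.

Lemma C1_coord (j : 'I_n) : C1 (fun x : 'rV[R]_n => x 0 j) /\
  forall i, partial i (fun x : 'rV[R]_n => x 0 j) = fun=> (j == i)%:R.
Proof.
apply: C1_intro.
- exact: coord_continuous.
- move=> i x; apply: is_derive_epsP => e e0; exists 1 => // h h0 _.
  by rewrite !mxE eqxx /= addrK mulKf // subrr normr0 ltW.
- by move=> i; exact: cont_cst.
Qed.

(** Squared Euclidean norm, used for everything that is differentiated; [|x|] is the sup norm, and
    the two are compared by [sqn_norm_lt] and [sqn_le_norm]. *)
Definition sqn (x : 'rV[R]_n) : R := \sum_i x 0 i ^+ 2.

Lemma sqn_ge0 x : 0 <= sqn x.
Proof. by apply: sumr_ge0 => i _; exact: sqr_ge0. Qed.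

Lemma sqn_coord (x : 'rV[R]_n) i : x 0 i ^+ 2 <= sqn x.
Proof.
rewrite /sqn (bigD1 i) //= lerDl; apply: sumr_ge0 => j _; exact: sqr_ge0.
Qed.

Lemma sqn_norm_lt (x : 'rV[R]_n) (r : R) : 0 < r -> sqn x < r ^+ 2 -> `|x| < r.
Proof.
move=> r0 xr; apply: norm_lt_coord => // i.
have := le_lt_trans (sqn_coord x i) xr; rewrite -[X in X < _]real_normK ?num_real //.
by move: `|x 0 i| (normr_ge0 (x 0 i)) => t t0 tr; rewrite ltNge; apply/negP => rt; nra.
Qed.

Lemma sqn_le_norm (x : 'rV[R]_n) : sqn x <= n%:R * `|x| ^+ 2.
Proof.
rewrite /sqn; apply: (@le_trans _ _ (\sum_(i < n) `|x| ^+ 2)).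
  apply: ler_sum => i _; rewrite -[leLHS]real_normK ?num_real //.
  by rewrite ler_pXn2r ?nnegrE // coord_le_norm.
by rewrite sumr_const card_ord mulr_natl.
Qed.

Lemma C1_sqn : C1 sqn /\ forall i, partial i sqn = fun x => 2 * x 0 i.
Proof.
apply: C1_intro.
- by apply: cont_sum => i; apply: contX; exact: coord_continuous.
- move=> i x.
  have -> : sqn = \sum_(j < n) (fun x : 'rV[R]_n => x 0 j * x 0 j).
    by apply/funext => y; rewrite fct_sumE; apply: eq_bigr => j _; rewrite expr2.
  have -> : 2 * x 0 i = \sum_(j < n) (x 0 j * (j == i)%:R + x 0 j * (j == i)%:R).
    rewrite (bigD1 i) //= big1 ?addr0.
      have -> : ((i == i)%:R : R) = 1 by rewrite eqxx.
      by ring.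
    by move=> j /negbTE ->; rewrite !mulr0 addr0.
  apply: is_derive_sum => j.
  have [Cj Ej] := C1_coord j.
  have [Cjj Ejj] := C1M Cj Cj.
  have -> : x 0 j * (j == i)%:R + x 0 j * (j == i)%:R =
      partial i (fun x : 'rV[R]_n => x 0 j * x 0 j) x by rewrite Ejj Ej.
  exact: C1_is_derive.
- by move=> i; apply: contM; [exact: cont_cst|exact: coord_continuous].
Qed.

Lemma C1_radial (P P' : R -> R) y : (forall s, is_derive s (1 : R) P (P' s)) ->
  continuous P' -> C1 (fun x => P (sqn (x - y))) /\
  forall i, partial i (fun x => P (sqn (x - y))) =
    fun x => P' (sqn (x - y)) * (2 * (x - y) 0 i).
Proof.
move=> dP cP'; have [Cs Es] := C1_sqn.
have [Csy Esy] := C1_shift (- y) Cs.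
have [C E] := C1_comp dP cP' Csy; split=> // i.
by rewrite E Esy Es.
Qed.

(** A syntactic class closed under all partial derivatives: smoothness of every order then follows
    from one first-order statement. The parameter [r] plays the role of a squared radius. *)
Inductive bump_algebra (r : R) : ('rV[R]_n -> R) -> Prop :=
| bump_expinv k : bump_algebra r (fun x => expinv k (r - sqn x))
| bump_coord i : bump_algebra r (fun x => x 0 i)
| bump_cst a : bump_algebra r (fun=> a)
| bump_add g h : bump_algebra r g -> bump_algebra r h -> bump_algebra r (fun x => g x + h x)
| bump_mul g h : bump_algebra r g -> bump_algebra r h -> bump_algebra r (fun x => g x * h x).

Lemma bump_algebra_C1 r g : bump_algebra r g ->
  C1 g /\ forall i, bump_algebra r (partial i g).
Proof.
elim=> {g} [k|j|a|g h Bg [Cg Pg] Bh [Ch Ph]|g h Bg [Cg Pg] Bh [Ch Ph]].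
- have [Cs Es] := C1_sqn.
  have [Cr Er] : C1 (fun x => r - sqn x) /\ forall i, partial i (fun x => r - sqn x) =
      fun x => -2 * x 0 i.
    have [CN EN] := C1Z (-1) Cs; have [CD ED] := C1D (C1_cst r).1 CN.
    have -> : (fun x => r - sqn x) = (fun x => r + -1 * sqn x).
      by apply/funext => x; rewrite mulN1r.
    split=> // i; rewrite ED EN Es (C1_cst r).2.
    by apply/funext => x; ring.
  have cexp m : continuous (@expinv R m) := is_derive_cont (is_derive_expinv m).
  have cd : continuous (fun q : R => expinv k.+2 q - k%:R * expinv k.+1 q).
    by apply: contB => //; apply: contM => //; exact: cont_cst.
  have [C E] := C1_comp (is_derive_expinv k) cd Cr; split=> // i.
  have -> : partial i (fun x => expinv k (r - sqn x)) = fun x =>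
     (expinv k.+2 (r - sqn x) + (- k%:R) * expinv k.+1 (r - sqn x)) * (-2 * x 0 i).
    by rewrite E Er; apply/funext => x /=; ring.
  apply: bump_mul; last by apply: bump_mul; [exact: bump_cst|exact: bump_coord].
  apply: bump_add; first exact: bump_expinv.
  by apply: bump_mul; [exact: bump_cst|exact: bump_expinv].
- have [C E] := C1_coord j; split=> // i; rewrite E; exact: (bump_cst r _).
- have [C E] := @C1_cst R n a; split=> // i; rewrite E; exact: (bump_cst r 0).
- have [C E] := C1D Cg Ch; split=> // i; rewrite E; exact: bump_add.
- have [C E] := C1M Cg Ch; split=> // i; rewrite E.
  by apply: bump_add; exact: bump_mul.
Qed.

Lemma conv_smooth r rho z : bump_algebra r rho -> Cc z -> smooth (conv 1 rho z).
Proof.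
move=> Brho Cz k; elim: k rho Brho => [|k IH] rho Brho;
  have [C1rho Prho] := bump_algebra_C1 Brho; have [C E] := conv_C1 1 C1rho Cz.
  by split=> //; exact: C1_cont.
split; first exact: C1_cont.
split; first by move=> x; exact: C1_differentiable.
by move=> i; rewrite E; exact: IH.
Qed.

End radial.

Section density.
Context {R : realType} {n : nat}.
Local Notation I := (@integral_Rn R n).

Lemma Cc_unif (g : 'rV[R]_n -> R) (e : R) : Cc g -> 0 < e ->
  exists2 d : R, 0 < d & forall x y, `|y - x| < d -> `|g y - g x| < e.
Proof.
move=> [cg [r r0 gr]] e0; have [d d0 H] := continuous_unif_rV (r + 1) cg e0.
exists (Num.min d 1); first by rewrite lt_min d0 ltr01.
move=> x y; rewrite lt_min => /andP[yd y1].
have [xr|rx] := leP `|x| (r + 1); first exact: H.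
have h1 := ler_normB (y - x) y; rewrite addrAC subrr add0r normrN in h1.
by rewrite !gr ?subrr ?normr0 //; lra.
Qed.

Lemma int_abs_le (g h : 'rV[R]_n -> R) : Cc g -> Cc h -> (forall x, `|g x| <= h x) ->
  `|I g| <= I h.
Proof.
move=> Cg Ch gh; rewrite ler_norml -intN //; apply/andP; split; apply: int_le => //.
- exact: CcN.
- by move=> x; have := gh x; rewrite ler_norml => /andP[].
- by move=> x; have := gh x; rewrite ler_norml => /andP[].
Qed.

Lemma conv_approx (g rho : 'rV[R]_n -> R) (e d : R) : Cc g -> Cc rho ->
  (forall x, 0 <= rho x) -> I rho = 1 -> (forall x, d <= `|x| -> rho x = 0) ->
  (forall x y, `|y - x| < d -> `|g y - g x| < e) ->
  forall x, `|conv (-1) g rho x - g x| <= e.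
Proof.
move=> Cg Crho rho0 rho1 rhod ge x.
have -> : conv (-1) g rho x - g x = I (fun y => (g (x + (-1) *: y) - g x) * rho y).
  have {1}-> : g x = I (fun y => g x * rho y) by rewrite intZ // rho1 mulr1.
  rewrite /conv -intB; last exact: CcZ.
    by congr I; apply/funext => y; rewrite mulrBl.
  exact: conv_integrand_Cc Cg.1 Crho.
have -> : e = I (fun y => e * rho y) by rewrite intZ // rho1 mulr1.
apply: int_abs_le.
- apply: CcMl => //; apply: contB; last exact: cont_cst.
  have [cg _] := Cg; exact: (cont_comp (@cont_affine R _ x (-1)) cg).
- exact: CcZ.
- move=> y; rewrite normrM [`|rho y|]ger0_norm //.
  have [yd|dy] := ltP `|y| d; last by rewrite rhod // !mulr0.
  rewrite ler_wpM2r // ltW //; apply: ge.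
  by rewrite addrC addKr scaleN1r normrN.
Qed.

(** Convolution with a normalized bump approximates [a] and its first partial derivatives at once,
    because the derivatives may be placed on [a]. *)
Lemma mollify (a : 'rV[R]_n -> R) (r e : R) : C1 a -> 0 <= r ->
  (forall x, r < `|x| -> a x = 0) -> 0 < e ->
  exists phi, [/\ test_fun phi, C1 phi, forall x, r + 1 < `|x| -> phi x = 0,
    forall x, `|phi x - a x| <= e &
    forall i x, `|partial i phi x - partial i a x| <= e].
Proof.
move=> C1a r0 ar e0.
have Ca : Cc a by split; [exact: C1_cont|exists r].
have [d0 d00 Hd0] := Cc_unif Ca e0.
have Hi i : exists2 d : R, 0 < d & forall x y, `|y - x| < d -> `|partial i a y - partial i a x| < e.
  by apply: Cc_unif => //; exact: partial_Cc.
pose D i := projT1 (cid2 (Hi i)).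
have D0 i : 0 < D i by rewrite /D; case: cid2.
have HD i x y : `|y - x| < D i -> `|partial i a y - partial i a x| < e.
  by rewrite /D; case: cid2 => /= t _; exact.
(* A common modulus for [a] and all its partial derivatives; capping it by 1 keeps the support
   within radius [r + 1]. *)
pose d := Num.min (Num.min d0 1) (\big[Num.min/1]_i D i).
have d_gt0 : 0 < d by rewrite !lt_min d00 ltr01 /=; apply/lt_bigmin.
have dd0 : d <= d0 by rewrite !ge_min lexx.
have d1 : d <= 1 by rewrite !ge_min lexx orbT.
have dD i : d <= D i by rewrite ge_min bigmin_le_cond ?orbT.
pose rho0 (x : 'rV[R]_n) := expinv 0 (d ^+ 2 - sqn x).
have B0 : bump_algebra (d ^+ 2) rho0 by exact: bump_expinv.
have rho0d x : d <= `|x| -> rho0 x = 0.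
  move=> dx; apply: expinv_le0; rewrite subr_le0 leNgt; apply/negP => /sqn_norm_lt.
  by move=> /(_ d_gt0); rewrite ltNge dx.
have Crho0 : Cc rho0.
  split; first by apply: C1_cont; exact: (bump_algebra_C1 B0).1.
  by exists d; [exact: ltW|move=> x /ltW; exact: rho0d].
have m0 : 0 < I rho0.
  apply: (@int_gt0 _ _ _ 0) => //; first by move=> x; exact: expinv_ge0.
  apply: expinv_gt0; rewrite /sqn big1 ?subr0 ?exprn_gt0 // => i _.
  by rewrite mxE expr0n.
pose rho x := (I rho0)^-1 * rho0 x.
have Brho : bump_algebra (d ^+ 2) rho by apply: bump_mul => //; exact: bump_cst.
have Crho : Cc rho by exact: CcZ.
have rhod x : d <= `|x| -> rho x = 0 by move=> dx; rewrite /rho rho0d ?mulr0.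
have rho_ge0 x : 0 <= rho x by rewrite mulr_ge0 ?expinv_ge0 // invr_ge0 ltW.
have rho1 : I rho = 1 by rewrite /rho intZ // mulVf // gt_eqF.
pose z (y : 'rV[R]_n) := a (- y).
have Cz : Cc z by exact: Cc_neg.
(* The same function in two forms: derivatives fall on the bump in the first, which gives
   smoothness, and on [a] in the second, which gives the approximation. *)
have E : conv 1 rho z = conv (-1) a rho.
  apply/funext => x.
  have CF : Cc (fun y => a (x + (-1) *: y) * rho y) by exact: conv_integrand_Cc Ca.1 Crho.
  rewrite /conv -(int_shift x CF); congr I; apply/funext => y.
  by rewrite scale1r scaleN1r opprD addrCA subrr addr0 mulrC [x + y]addrC.
have [C1c Ec] := conv_C1 (-1) C1a Crho.
have supp x : r + 1 < `|x| -> conv (-1) a rho x = 0.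
  move=> rx; rewrite /conv -[RHS](@int0 R n); congr I; apply/funext => y.
  have [yd|dy] := ltP `|y| d; last by rewrite rhod ?mulr0.
  rewrite ar ?mul0r // scaleN1r.
  by have := ler_normD (x - y) y; rewrite subrK; lra.
exists (conv (-1) a rho); split => //.
- split; first by rewrite -E; exact: (conv_smooth Brho Cz).
  by exists (r + 1).
- apply: (@conv_approx a rho e d) => // x y yx; apply: Hd0; exact: lt_le_trans yx dd0.
- move=> i; rewrite Ec; apply: (@conv_approx _ rho e d) => //; first exact: partial_Cc.
  by move=> x y yx; apply: HD; exact: lt_le_trans yx (dD i).
Qed.

(** If the form were negative at [a], a mollification close to [a] in [C^1], supported in a fixed
    ball, would still make it negative. *)
Lemma stable_C1 (f : R -> R) (u a : 'rV[R]_n -> R) : stable f u ->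
  continuous (fun x => f^`()%classic (u x)) -> C1 a -> Cc a ->
  0 <= Qform (fun x => f^`()%classic (u x)) a.
Proof.
move=> st; set c := fun x => _; move=> cc C1a Ca.
have [ca [r r0 ar]] := Ca.
have [M M0 HM] := continuous_bounded_rV (r + 1) cc.
have [A A0 HA] := Cc_bounded Ca.
have [A' A'0 HA'] : exists2 B, 0 <= B & forall i x, `|partial i a x| <= B.
  have H i : exists2 B, 0 <= B & forall x, `|partial i a x| <= B.
    by apply: Cc_bounded; exact: partial_Cc.
  pose B i := projT1 (cid2 (H i)).
  have HB i x : `|partial i a x| <= B i by rewrite /B; case: cid2 => /= t _; exact.
  exists (\big[Num.max/0]_i B i); first exact: bigmax_ge_id.
  by move=> i x; apply: le_trans (HB i x) (le_bigmax _ _ _).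
rewrite leNgt; apply/negP => Qlt0.
(* Since [e <= 1], an error [e] changes the square of a quantity bounded by [B] by at most
   [e (2 B + 1)]; [K] sums this over the [n] partial derivatives and the potential term. *)
pose K := n%:R * (2 * A' + 1) + M * (2 * A + 1).
have K0 : 0 <= K by rewrite addr_ge0 // mulr_ge0 // addr_ge0 // mulr_ge0.
pose P := K * (2 * (r + 1)) ^+ n + 1.
have P0 : 0 < P by rewrite ltr_wpDl // mulr_ge0 // exprn_ge0 // mulr_ge0 // addr_ge0.
pose e := Num.min 1 (- Qform c a / P).
have e0 : 0 < e by rewrite lt_min ltr01 /= divr_gt0 // oppr_gt0.
have e1 : e <= 1 by rewrite ge_min lexx.
have eP : e * P <= - Qform c a by rewrite -ler_pdivlMr // ge_min lexx orbT.
have [phi [Tphi C1phi phir pa dpa]] := mollify C1a r0 ar e0.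
have Cphi : Cc phi.
  by split; [exact: C1_cont|exists (r + 1) => //; rewrite addr_ge0].
have := st phi Tphi; rewrite -/(Qform c phi) => Qphi.
have CQa := Qform_Cc cc C1a Ca.
have CQp := Qform_Cc cc C1phi Cphi.
have : `|Qform c phi - Qform c a| <= e * K * (2 * (r + 1)) ^+ n.
  rewrite /Qform -intB //; apply: int_bound.
  - by rewrite addr_ge0.
  - exact: (CcB CQp CQa).1.
  - move=> x rx; have rx' : r < `|x| by lra.
    rewrite /grad_sq !big1 ?phir ?ar // ?expr0n /= ?mulr0 ?subr0 ?subrr //.
      by move=> i _; rewrite (partial_supp i ar) // expr0n.
    by move=> i _; rewrite (partial_supp i phir) // expr0n.
  - move=> x; have [xr|rx] := leP `|x| (r + 1); last first.
      have rx' : r < `|x| by lra.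
      rewrite /grad_sq !big1 ?phir ?ar // ?expr0n /= ?mulr0 ?subr0 ?subrr ?normr0.
      + by rewrite mulr_ge0 // ltW.
      + by move=> i _; rewrite (partial_supp i ar) // expr0n.
      + by move=> i _; rewrite (partial_supp i phir) // expr0n.
    have sq_le (s t B : R) : `|t| <= B -> `|s - t| <= e -> `|s ^+ 2 - t ^+ 2| <= e * (2 * B + 1).
      move=> tB st_e; rewrite subr_sqr normrM ler_pM //.
      have -> : s + t = (s - t) + 2 * t by ring.
      rewrite (le_trans (ler_normD _ _)) // normrM ger0_norm //; lra.
    have -> : grad_sq phi x - c x * phi x ^+ 2 - (grad_sq a x - c x * a x ^+ 2) =
       \sum_(i < n) (partial i phi x ^+ 2 - partial i a x ^+ 2)
       - c x * (phi x ^+ 2 - a x ^+ 2).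
      rewrite sumrB -/(grad_sq phi x) -/(grad_sq a x); ring.
    rewrite (le_trans (ler_normB _ _)) // /K [e * (_ + _)]mulrDr lerD //.
      apply: le_trans (ler_norm_sum _ _ _) _.
      apply: (@le_trans _ _ (\sum_(i < n) e * (2 * A' + 1))).
        by apply: ler_sum => i _; apply: sq_le.
      by rewrite sumr_const card_ord -[_ *+ n]mulr_natl mulrCA.
    rewrite normrM mulrCA ler_pM //; first exact: HM.
    exact: sq_le.
rewrite ler_norml => /andP[_].
have : e * P = e * K * (2 * (r + 1)) ^+ n + e by rewrite /P; ring.
lra.
Qed.

End density.

(** * Truncations, cutoffs and barriers *)

Section truncation.
Context {R : realType}.

Lemma is_derive_eps {V : normedModType R} (g : V -> R) x v (d e : R) :
  is_derive x v g d -> 0 < e -> exists2 dl : R, 0 < dl & forall h, h != 0 -> `|h| < dl ->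
    `|h^-1 * (g (h *: v + x) - g x) - d| <= e.
Proof.
move=> [dg <-] e0; have /cvgrPdistC_le/(_ _ e0)/nbhs_ballP[dl /= dl0 H] := dg.
exists dl => // h h0 hd; apply: H => //.
by rewrite -ball_normE /= sub0r normrN.
Qed.

Lemma is_derive_glue (phi dphi : R -> R) (s : R) :
  (forall t : R, 0 <= t -> is_derive t (1 : R) phi (dphi t)) -> phi 0 = 0 -> dphi 0 = 0 ->
  is_derive s (1 : R) (fun t => if 0 < t then phi t else 0) (if 0 < s then dphi s else 0).
Proof.
move=> H phi0 dphi0; have [s0|s0|->] := ltgtP s 0.
- have D0 : is_derive s (1 : R) (fun _ : R => 0 : R) 0 by exact: is_derive_cst.
  apply: near_eq_is_derive D0.
  near=> t; rewrite ifF //; apply/negbTE; rewrite -leNgt ltW //; near: t; exact: lt_nbhsl.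
- apply: near_eq_is_derive (H s (ltW s0)).
  by near=> t; rewrite ifT //; near: t; exact: lt_nbhsr.
- apply: is_derive_epsP => e e0; have [d d0 Hd] := is_derive_eps (H 0 (lexx _)) e0.
  exists d => // h h0 hd; have := Hd h h0 hd; rewrite ltxx.
  rewrite phi0 dphi0 !subr0 [h *: 1]mulr1 addr0.
  by case: ifP => // _ _; rewrite mulr0 normr0 ltW.
Unshelve. all: by end_near.
Qed.

(** The power [s_+^k] of the positive part. It is of class [C^(k-1)] for [k >= 1], and [pospow 0] is
    the indicator of the positive numbers. *)
Definition pospow (k : nat) (s : R) : R := if 0 < s then s ^+ k else 0.

Lemma pospow_ge0 k s : 0 <= pospow k s.
Proof. by rewrite /pospow; case: ifP => // s0; rewrite exprn_ge0 // ltW. Qed.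

Lemma pospow_le0 k s : s <= 0 -> pospow k s = 0.
Proof. by rewrite /pospow ltNge => ->. Qed.

Lemma pospow_gt0 k s : 0 < s -> pospow k s = s ^+ k.
Proof. by rewrite /pospow => ->. Qed.

Lemma pospow_le1 k s : s <= 1 -> pospow k s <= 1.
Proof.
by rewrite /pospow; case: ifP => // s0 s1; rewrite exprn_ile1 // ltW.
Qed.

Lemma is_derive_pospow k s :
  is_derive s (1 : R) (pospow k.+2) (k.+2%:R * pospow k.+1 s).
Proof.
have H t : is_derive t (1 : R) (fun t : R => t ^+ k.+2) (k.+2%:R * t ^+ k.+1).
  by apply: (is_derive_eq (is_derive_pow k.+2 (is_derive_id t (1 : R)))); rewrite mulr1.
have := @is_derive_glue (fun t => t ^+ k.+2) (fun t => k.+2%:R * t ^+ k.+1) s.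
rewrite !expr0n mulr0 => /(_ (fun t _ => H t) erefl erefl).
by rewrite /pospow; case: ifP => // _; rewrite mulr0.
Qed.

Lemma pospow1_cont : continuous (pospow 1).
Proof.
have -> : pospow 1 = fun t : R => (t + `|t|) / 2.
  apply/funext => t; rewrite /pospow; case: ltP => t0.
    by rewrite gtr0_norm // expr1; lra.
  by rewrite ler0_norm //; lra.
apply: contM; last exact: cont_cst.
apply: contD; first by move=> t; exact: cvg_id.
by move=> t; exact: (@norm_continuous R R^o t).
Qed.

Lemma pospow_cont k : continuous (pospow k.+1).
Proof.
have -> : pospow k.+1 = fun t : R => pospow 1 t ^+ k.+1.
  by apply/funext => t; rewrite /pospow; case: ifP; rewrite ?expr1 // expr0n.
by apply: contX; exact: pospow1_cont.
Qed.

Lemma contV {T : topologicalType} (f : T -> R) : continuous f -> (forall x, f x != 0) ->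
  continuous (fun x => (f x)^-1).
Proof. by move=> cf f0 x; apply: cvgV; [exact: f0|exact: cf]. Qed.

(* [G s = s_+^2 / (s_+ + e)] is a C^1 convex regularisation of the positive part with
   [G^2 - s G G'] of order [e]; [H = G G'] is again C^1. *)
Lemma truncation_exists (e : R) : 0 < e -> e <= 1 -> exists G G' H H' : R -> R,
  [/\ (forall s, is_derive s (1 : R) G (G' s)) /\ continuous G',
      (forall s, is_derive s (1 : R) H (H' s)) /\ continuous H',
      (forall s, H s = G s * G' s) /\ (forall s, G' s ^+ 2 <= H' s),
      (forall s, G s ^+ 2 <= s ^+ 2) /\ (forall s, `|s * H s - G s ^+ 2| <= e * `|s|) &
      (forall s, pospow 2 s / (pospow 1 s + 1) <= G s) /\ (forall s, s <= 0 -> G s = 0)].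
Proof.
move=> e0 e1; set p := pospow 1.
have p0 s : 0 <= p s by exact: pospow_ge0.
have pe s : p s + e != 0 by rewrite gt_eqF // ltr_wpDl.
have cp : continuous p by exact: pospow1_cont.
have cpe : continuous (fun s => p s + e) by apply: contD => //; exact: cont_cst.
have cinv k : continuous (fun s => ((p s + e) ^+ k)^-1).
  by apply: contV; [exact: contX|move=> s; rewrite expf_neq0].
pose G s := p s ^+ 2 / (p s + e).
pose G' s := (p s ^+ 2 + 2 * e * p s) / (p s + e) ^+ 2.
pose H s := p s ^+ 3 * (p s + 2 * e) / (p s + e) ^+ 3.
pose H' s := ((p s ^+ 2 + 2 * e * p s) ^+ 2 + 2 * e ^+ 2 * p s ^+ 2) / (p s + e) ^+ 4.
have glueE (F : R -> R) : F 0 = 0 -> (fun s => F (p s)) = (fun s => if 0 < s then F s else 0).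
  by move=> F0; apply/funext => s; rewrite /p /pospow; case: ifP => // _; rewrite expr1.
have dinv (t : R) : 0 <= t -> is_derive t (1 : R) (fun t : R => (t + e)^-1) (- (t + e) ^- 2).
  move=> t0; have te : t + e != 0 by rewrite gt_eqF // ltr_wpDl.
  have dte := is_derive_addr e t.
  by apply: (is_derive_eq (@is_deriveV _ (fun t => t + e) t 1 1 te dte)); rewrite scaleRE mulr1.
have dpow k (t : R) : is_derive t (1 : R) (fun t : R => t ^+ k) (k%:R * t ^+ k.-1).
  by apply: (is_derive_eq (is_derive_pow k (is_derive_id t (1 : R)))); rewrite mulr1.
exists G, G', H, H'; split.
- split; last first.
    apply: contM; last exact: cinv.
    by apply: contD; [exact: contX|apply: contM => //; exact: cont_cst].
  move=> s.
  pose F t := t ^+ 2 / (t + e); pose F' t := (t ^+ 2 + 2 * e * t) / (t + e) ^+ 2.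
  have F0 : F 0 = 0 by rewrite /F expr0n mul0r.
  have F'0 : F' 0 = 0 by rewrite /F' expr0n mulr0 addr0 mul0r.
  have -> : G = (fun s => if 0 < s then F s else 0) by exact: (glueE F).
  have -> : G' s = (if 0 < s then F' s else 0) by exact: (congr1 (@^~ s) (glueE F' F'0)).
  apply: is_derive_glue => // t t0; have te : t + e != 0 by rewrite gt_eqF // ltr_wpDl.
  apply: (is_derive_eq (is_deriveM (dpow 2 t) (dinv t t0))).
  by rewrite !scaleRE /F' /= expr1; field.
- split; last first.
    apply: contM; last exact: cinv.
    apply: contD; last by apply: contM; [exact: cont_cst|exact: contX].
    by apply: contX; apply: contD; [exact: contX|apply: contM => //; exact: cont_cst].
  move=> s.
  pose F t := t ^+ 3 * (t + 2 * e) / (t + e) ^+ 3.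
  pose F' t := ((t ^+ 2 + 2 * e * t) ^+ 2 + 2 * e ^+ 2 * t ^+ 2) / (t + e) ^+ 4.
  have F0 : F 0 = 0 by rewrite /F expr0n !mul0r.
  have F'0 : F' 0 = 0 by rewrite /F' !expr2 !(mulr0, addr0, mul0r).
  have -> : H = (fun s => if 0 < s then F s else 0) by exact: (glueE F).
  have -> : H' s = (if 0 < s then F' s else 0) by exact: (congr1 (@^~ s) (glueE F' F'0)).
  apply: is_derive_glue => // t t0; have te : t + e != 0 by rewrite gt_eqF // ltr_wpDl.
  have dlin := is_derive_addr (2 * e) t.
  have -> : F = (fun t => t ^+ 3) * (fun t => t + 2 * e) * (fun t => (t + e)^-1 ^+ 3).
    by apply/funext => z; rewrite /F -exprVn.
  apply: (is_derive_eq (is_deriveM (is_deriveM (dpow 3 t) dlin) (is_derive_pow 3 (dinv t t0)))).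
  rewrite !scaleRE /F' /= mulrfctE.
  by field.
- split=> s; first by rewrite /H /G /G'; field; exact: pe.
  rewrite /G' /H' -subr_ge0.
  have -> : ((p s ^+ 2 + 2 * e * p s) ^+ 2 + 2 * e ^+ 2 * p s ^+ 2) / (p s + e) ^+ 4 -
    ((p s ^+ 2 + 2 * e * p s) / (p s + e) ^+ 2) ^+ 2 =
    2 * e ^+ 2 * p s ^+ 2 * (((p s + e) ^+ 2)^-1) ^+ 2 by field; exact: pe.
  apply: mulr_ge0; last exact: sqr_ge0.
  apply: mulr_ge0; last exact: sqr_ge0.
  by apply: mulr_ge0 => //; exact: sqr_ge0.
- have pos s : 0 < p s + e by rewrite ltr_wpDl.
  have ps s : p s <= `|s|.
    by rewrite /p /pospow; case: ifP => // s0; rewrite expr1 ler_norm.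
  split=> s.
    rewrite -[s ^+ 2]real_normK ?num_real // ler_pXn2r ?nnegrE //; last first.
      by rewrite divr_ge0 ?sqr_ge0 // ltW.
    rewrite (le_trans _ (ps s)) // /G ler_pdivrMr // expr2 ler_wpM2l //.
    by rewrite lerDl ltW.
  have -> : s * H s = p s * H s.
    by rewrite /H /p /pospow; case: ifP => _; rewrite ?expr1 // expr0n !mul0r !mulr0.
  have -> : p s * H s - G s ^+ 2 = e * (p s * (p s / (p s + e)) ^+ 3).
    by rewrite /H /G; field; exact: pe.
  have q0 : 0 <= p s / (p s + e) by rewrite divr_ge0 // ltW.
  have q1 : p s / (p s + e) <= 1 by rewrite ler_pdivrMr // mul1r lerDl ltW.
  have h : 0 <= p s * (p s / (p s + e)) ^+ 3 by rewrite mulr_ge0 // exprn_ge0.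
  rewrite ger0_norm; last by rewrite mulr_ge0 // ltW.
  rewrite ler_pM2l //; apply: le_trans (ps s).
  by rewrite ler_piMr // exprn_ile1.
(* Here [e <= 1] enters: the lower bound, which is [G] for [e = 1], does not depend on [e], so it
   survives when [e] is chosen last. *)
- split=> s; last by move=> s0; rewrite /G /p pospow_le0 // expr0n mul0r.
  rewrite /G -/(p s).
  have -> : pospow 2 s = p s ^+ 2.
    by rewrite /p /pospow; case: ifP => _; rewrite ?expr1 // expr0n.
  by rewrite ler_wpM2l ?sqr_ge0 // lef_pV2 ?posrE ?ltr_wpDl // lerD2l.
Qed.

End truncation.

(** * Radial cutoffs *)

Section cutoff.
Context {R : realType} {n : nat}.

(** Equal to 1 up to [t = 1] and to 0 from [t = 2] on. The cubes make it [C^2], because its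
    derivative is itself used as a [C^1] cutoff. *)
Definition step (t : R) : R := pospow 3 (1 - pospow 3 (t - 1)).
(** Minus the derivative of [step], hence nonnegative; [ddstep] is the derivative of [dstep]. *)
Definition dstep (t : R) : R := 9 * (pospow 2 (1 - pospow 3 (t - 1)) * pospow 2 (t - 1)).
Definition ddstep (t : R) : R :=
  9 * (pospow 2 (1 - pospow 3 (t - 1)) * (2 * pospow 1 (t - 1)) +
     pospow 2 (t - 1) * (- (6 * (pospow 1 (1 - pospow 3 (t - 1)) * pospow 2 (t - 1))))).

Lemma is_derive_inner (t : R) : is_derive t (1 : R) (fun t => 1 - pospow 3 (t - 1))
  (- (3 * pospow 2 (t - 1))).
Proof.
have dt1 := is_derive_addr (-1) t.
have d3 : is_derive t (1 : R) (fun t => pospow 3 (t - 1)) (3 * pospow 2 (t - 1)).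
  have H := @is_derive_comp R R^o (pospow 3) (fun t => t - 1) t 1 _ _
    (is_derive_pospow 1 (t - 1)) dt1.
  by apply: (is_derive_eq H); rewrite mulr1.
by apply: (is_derive_eq (is_deriveB (is_derive_cst (1 : R) t (1 : R)) d3)); rewrite sub0r.
Qed.

Lemma is_derive_step (t : R) : is_derive t (1 : R) step (- dstep t).
Proof.
apply: (is_derive_eq (is_derive_comp (is_derive_pospow 1 _) (is_derive_inner t))).
by rewrite /dstep; ring.
Qed.

Lemma is_derive_dstep (t : R) : is_derive t (1 : R) dstep (ddstep t).
Proof.
have dt1 := is_derive_addr (-1) t.
have d2 : is_derive t (1 : R) (fun t => pospow 2 (t - 1)) (2 * pospow 1 (t - 1)).
  have H := @is_derive_comp R R^o (pospow 2) (fun t => t - 1) t 1 _ _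
    (is_derive_pospow 0 (t - 1)) dt1.
  by apply: (is_derive_eq H); rewrite mulr1.
have di := is_derive_comp (is_derive_pospow 0 _) (is_derive_inner t).
apply: (is_derive_eq (is_deriveM (is_derive_cst (9 : R) t (1 : R)) (is_deriveM di d2))).
by rewrite /ddstep !scaleRE mulrfctE; ring.
Qed.

Lemma inner_cont : continuous (fun t : R => 1 - pospow 3 (t - 1)).
Proof. exact: is_derive_cont is_derive_inner. Qed.

Lemma shift1_cont : continuous (fun t : R => t - 1).
Proof. exact: (@cont_shift R R^o (-1)). Qed.

Lemma dstep_cont : continuous dstep.
Proof. exact: is_derive_cont is_derive_dstep. Qed.

Lemma ddstep_cont : continuous ddstep.
Proof.
have ci k := cont_comp inner_cont (@pospow_cont R k).
have cs k := cont_comp shift1_cont (@pospow_cont R k).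
apply: contM; first exact: cont_cst.
apply: contD; apply: contM => //.
  by apply: contM => //; exact: cont_cst.
by apply: contN; apply: contM; [exact: cont_cst|exact: contM].
Qed.

Lemma step1 t : t <= 1 -> step t = 1.
Proof.
by move=> t1; rewrite /step (@pospow_le0 _ _ (t - 1)) ?subr_le0 // subr0 pospow_gt0 ?expr1n.
Qed.

Lemma inner_le0 (t : R) : 2 <= t -> 1 - pospow 3 (t - 1) <= 0.
Proof.
move=> t2; rewrite pospow_gt0; last by lra.
by rewrite subr_le0 exprn_ege1 //; lra.
Qed.

Lemma step_eq0 t : 2 <= t -> step t = 0.
Proof. by move=> t2; rewrite /step pospow_le0 // inner_le0. Qed.

Lemma dstep_supp t : dstep t != 0 -> 1 <= t /\ t <= 2.
Proof.
move=> d0; split; rewrite leNgt; apply/negP => ht; move/eqP: d0; apply; rewrite /dstep.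
  have z k : pospow k (t - 1) = 0 by apply: pospow_le0; lra.
  by rewrite !z !mulr0.
by rewrite pospow_le0 ?mul0r ?mulr0 // inner_le0 // ltW.
Qed.

Lemma ddstep_supp t : ddstep t != 0 -> 1 <= t /\ t <= 2.
Proof.
move=> d0; split; rewrite leNgt; apply/negP => ht; move/eqP: d0; apply; rewrite /ddstep.
  have z k : pospow k (t - 1) = 0 by apply: pospow_le0; lra.
  by rewrite !z !(mulr0, mul0r, addr0).
by rewrite !(@pospow_le0 _ _ (1 - _)) ?inner_le0 ?ltW // !(mulr0, mul0r, oppr0, addr0).
Qed.

(** After expansion the coefficients are 18 and 54, each in front of a quantity in [[0, 1]]; 72 is
    their sum. *)
Lemma ddstep_bound t : `|ddstep t| <= 72.
Proof.
have [->|/ddstep_supp [t1 t2]] := eqVneq (ddstep t) 0; first by rewrite normr0.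
have b k : 0 <= pospow k (t - 1) <= 1.
  by rewrite pospow_ge0 pospow_le1 //; lra.
have c k : 0 <= pospow k (1 - pospow 3 (t - 1)) <= 1.
  by rewrite pospow_ge0 pospow_le1 //; have /andP[? _] := b 3; lra.
rewrite /ddstep; move: (b 1%N) (b 2) (c 1%N) (c 2) => {b c}.
move: (pospow 1 (t - 1)) (pospow 2 (t - 1)) => a1 a2.
move: (pospow 1 _) (pospow 2 _) => c1 c2.
move=> /andP[a10 a11] /andP[a20 a21] /andP[c10 c11] /andP[c20 c21].
have h1 : 0 <= c2 * a1 <= 1 by rewrite mulr_ge0 // mulr_ile1.
have h2 : 0 <= a2 * (c1 * a2) <= 1.
  by rewrite !mulr_ge0 // mulr_ile1 ?mulr_ge0 // mulr_ile1.
have -> : 9 * (c2 * (2 * a1) + a2 * - (6 * (c1 * a2))) =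
  18 * (c2 * a1) - 54 * (a2 * (c1 * a2)) by ring.
by move: h1 h2 => /andP[? ?] /andP[? ?]; rewrite ler_norml; apply/andP; split; lra.
Qed.

Lemma C1_scaled (F F' : R -> R) (l : R) : (forall t, is_derive t (1 : R) F (F' t)) ->
  continuous F' ->
  C1 (fun x : 'rV[R]_n => F (l * sqn x)) /\
  forall x, grad_sq (fun x : 'rV[R]_n => F (l * sqn x)) x =
    4 * l ^+ 2 * sqn x * F' (l * sqn x) ^+ 2.
Proof.
move=> dF cF'; have [Cs Es] := @C1_sqn R n.
have [Cl El] := C1Z l Cs; have [C E] := C1_comp dF cF' Cl.
split=> // x; rewrite /grad_sq mulrAC mulr_sumr; apply: eq_bigr => i _.
rewrite E El Es; ring.
Qed.

Lemma scaled_supp (F : R -> R) (r : R) : 0 < r -> (forall t, 2 < t -> F t = 0) ->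
  forall x : 'rV[R]_n, 2 * r < `|x| -> F ((r ^+ 2)^-1 * sqn x) = 0.
Proof.
move=> r0 F0 x rx; apply: F0; rewrite ltr_pdivlMl ?exprn_gt0 // ltNge; apply/negP => h.
have : `|x| < 2 * r.
  apply: sqn_norm_lt; first by rewrite mulr_gt0.
  have r2 : 0 < r ^+ 2 by rewrite exprn_gt0.
  have -> : (2 * r) ^+ 2 = 4 * r ^+ 2 by ring.
  by lra.
by rewrite ltNge ltW.
Qed.

End cutoff.

(** * The Hopf barrier *)

Section barrier.
Context {R : realType} {n : nat}.
Variables (y : 'rV[R]_n) (T : R) (m : nat).

(** A polynomial Hopf barrier with compact support built in. The exponent is at least 3 so that it
    is [C^2] across the boundary, and [m] is left free to be taken large. *)
Definition barrier (x : 'rV[R]_n) := pospow m.+3 (T - sqn (x - y)).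

Lemma is_derive_subl (P P' : R -> R) (t : R) : is_derive (T - t) (1 : R) P (P' (T - t)) ->
  is_derive t (1 : R) (fun s : R => P (T - s)) (- P' (T - t)).
Proof.
move=> HP; have d1 : is_derive t (1 : R) (fun s : R => T - s) (-1).
  apply: (is_derive_eq (is_deriveB (is_derive_cst T t (1 : R)) (is_derive_id t (1 : R)))).
  by rewrite sub0r.
by apply: (is_derive_eq (@is_derive_comp R R^o P (fun s => T - s) t 1 _ _ HP d1)); rewrite mulrN1.
Qed.

Lemma subl_cont : continuous (fun s : R => T - s).
Proof. by apply: contB; [exact: cont_cst|move=> s; exact: cvg_id]. Qed.

Lemma barrier_C2 : C2 barrier /\ forall x, laplacian barrier x =
  4 * sqn (x - y) * (m.+3%:R * m.+2%:R * pospow m.+1 (T - sqn (x - y)))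
  - 2 * n%:R * (m.+3%:R * pospow m.+2 (T - sqn (x - y))).
Proof.
have d1 t : is_derive t (1 : R) (fun s => pospow m.+3 (T - s)) (- (m.+3%:R * pospow m.+2 (T - t))).
  by apply: (@is_derive_subl _ (fun z => m.+3%:R * pospow m.+2 z)); exact: is_derive_pospow.
have d2 t : is_derive t (1 : R) (fun s => - (m.+3%:R * pospow m.+2 (T - s)))
    (m.+3%:R * m.+2%:R * pospow m.+1 (T - t)).
  have H := @is_derive_subl _ (fun z => m.+2%:R * pospow m.+1 z) t (is_derive_pospow _ _).
  have -> : (fun s => - (m.+3%:R * pospow m.+2 (T - s))) =
     (- m.+3%:R) \*: (fun s => pospow m.+2 (T - s)).
    by apply/funext => s /=; rewrite scaleRE mulNr.
  by apply: (is_derive_eq (is_deriveZ _ H)); rewrite scaleRE; ring.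
have c1 k (a : R) : continuous (fun s => a * pospow k.+1 (T - s)).
  apply: contM; first exact: cont_cst.
  exact: cont_comp subl_cont (@pospow_cont R k).
have [C E] := C1_radial y d1 (contN (c1 _ _)).
have [C' E'] := C1_radial y d2 (c1 _ _).
have Ci i : C1 (fun x => - (m.+3%:R * pospow m.+2 (T - sqn (x - y))) * (2 * (x - y) 0 i)) /\
    forall j x, partial j (fun x =>
      - (m.+3%:R * pospow m.+2 (T - sqn (x - y))) * (2 * (x - y) 0 i)) x =
    - (m.+3%:R * pospow m.+2 (T - sqn (x - y))) * (2 * (i == j)%:R) +
    (2 * (x - y) 0 i) * (m.+3%:R * m.+2%:R * pospow m.+1 (T - sqn (x - y)) * (2 * (x - y) 0 j)).
  have [Cc Ec] := @C1_coord R n i.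
  have [Cs Es] := C1_shift (- y) Cc.
  have [Cz Ez] := C1Z 2 Cs.
  have [Cm Em] := C1M C' Cz.
  by split=> // j x; rewrite Em E' Ez Es Ec.
split; first by split=> // i; rewrite E; exact: (Ci i).1.
move=> x; rewrite /laplacian.
under eq_bigr => i _ do rewrite E (Ci i).2 eqxx.
rewrite big_split /= sumr_const card_ord addrC -[_ *+ n]mulr_natl; congr (_ + _); last by ring.
set A := m.+3%:R * m.+2%:R * _.
rewrite /sqn mulrAC mulr_sumr; apply: eq_bigr => i _; ring.
Qed.

Lemma barrier_norm x : 1 <= T -> 0 < T - sqn (x - y) -> `|x| < `|y| + T.
Proof.
move=> T1; rewrite subr_gt0 => h.
have : `|x - y| < T.
  by apply: sqn_norm_lt; [lra|apply: (lt_le_trans h); nra].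
by have := ler_normD (x - y) y; rewrite subrK; lra.
Qed.

Lemma barrier_Cc : 1 <= T -> Cc barrier /\ Cc (laplacian barrier).
Proof.
move=> T1; have [[[cb _] Cpb] L] := barrier_C2.
have s0 : 0 <= `|y| + T by rewrite addr_ge0 //; lra.
have out x : `|y| + T < `|x| -> T - sqn (x - y) <= 0.
  by move=> h; rewrite leNgt; apply/negP => /(barrier_norm T1); rewrite ltNge ltW.
split; split=> //.
- by exists (`|y| + T) => // x /out h; rewrite /barrier pospow_le0.
- by apply: cont_sum => i; exact: C1_partial_cont (Cpb i).
- by exists (`|y| + T) => // x /out h; rewrite L !pospow_le0 // !mulr0 subr0.
Qed.

(** After division by [(T - s)^(m+1)] with [s = sqn (x - y)], the radial second derivative
    contributes order [m^2], against order [m] for the rest of the Laplacian and order 1 for the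
    potential. Away from the centre, where [s >= d], it wins for large [m]. *)
Lemma barrier_subsol (K d c : R) x : 0 <= K -> 0 < T -> 0 < d ->
  2 * n%:R * T + K * T ^+ 2 < 4 * d * m.+2%:R ->
  d <= sqn (x - y) -> 0 < T - sqn (x - y) -> - K <= c ->
  0 < laplacian barrier x + c * barrier x.
Proof.
move=> K0 T0 d0 hm dx t0 cK; rewrite barrier_C2.2 /barrier !pospow_gt0 //.
have s0 := @sqn_ge0 R n (x - y).
move: (sqn (x - y)) dx t0 s0 => s ds t0 s0.
have tT : T - s <= T by lra.
have M0 : 0 < (m.+2%:R : R) by rewrite ltr0n.
have -> : 4 * s * (m.+3%:R * m.+2%:R * (T - s) ^+ m.+1) -
  2 * n%:R * (m.+3%:R * (T - s) ^+ m.+2) + c * (T - s) ^+ m.+3 =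
  (T - s) ^+ m.+1 * (m.+3%:R * (4 * s * m.+2%:R - 2 * n%:R * (T - s)) + c * (T - s) ^+ 2).
  by rewrite !exprS; ring.
rewrite mulr_gt0 ?exprn_gt0 //.
have h1 : 4 * d * m.+2%:R <= 4 * s * m.+2%:R by rewrite (ler_pM2r M0); lra.
have h2 : 2 * n%:R * (T - s) <= 2 * n%:R * T by rewrite ler_wpM2l ?mulr_ge0.
have h3 : (T - s) ^+ 2 <= T ^+ 2 by have := mulr_ge0 s0 (ltW t0); nra.
have h4 : - (K * T ^+ 2) <= c * (T - s) ^+ 2.
  have : - (K * (T - s) ^+ 2) <= c * (T - s) ^+ 2 by rewrite -mulNr ler_wpM2r // sqr_ge0.
  have : K * (T - s) ^+ 2 <= K * T ^+ 2 by rewrite ler_wpM2l.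
  lra.
have KT : 0 <= K * T ^+ 2 by rewrite mulr_ge0 // sqr_ge0.
have h5 : K * T ^+ 2 < 4 * s * m.+2%:R - 2 * n%:R * (T - s) by lra.
have h6 : 4 * s * m.+2%:R - 2 * n%:R * (T - s) <=
   m.+3%:R * (4 * s * m.+2%:R - 2 * n%:R * (T - s)).
  by rewrite ler_peMl ?ler1n //; lra.
lra.
Qed.

End barrier.

(** * Decay at infinity *)

Section comparison.
Context {R : realType}.

Lemma second_derivative_at_max (g g1 : R -> R) (g2 d : R) : 0 < d ->
  (forall t, `|t| < d -> is_derive t (1 : R) g (g1 t)) ->
  is_derive (0 : R) (1 : R) g1 g2 -> (forall t, `|t| < d -> g t <= g 0) -> g2 <= 0.
Proof.
move=> d0 Hg Hg1 gmax.
have in_d t : t \in `](- d), d[ -> `|t| < d by rewrite in_itv /= ltr_norml.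
have g10 : g1 0 = 0.
  have g'0 : is_derive (0 : R) (1 : R) g 0.
    apply: (@derive1_at_max _ g (- d) d) => //.
    - lra.
    - by move=> t /in_d td; have [] := Hg t td.
    - by rewrite in_itv /= oppr_lt0 d0.
    - by move=> t /in_d td; exact: gmax.
  have h : `|0 : R| < d by rewrite normr0.
  by have [_ <-] := Hg 0 h; have [_ ->] := g'0.
rewrite leNgt; apply/negP => g20.
have e0 : 0 < g2 / 2 by rewrite divr_gt0.
have [dl dl0 Hdl] := is_derive_eps Hg1 e0.
have [h h0 [hd hdl]] : exists2 h : R, 0 < h & h < d /\ h < dl.
  exists (Num.min d dl / 2); first by rewrite divr_gt0 // lt_min d0.
  have h1 : Num.min d dl <= d by rewrite ge_min lexx.
  have h2 : Num.min d dl <= dl by rewrite ge_min lexx orbT.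
  have h3 : 0 < Num.min d dl by rewrite lt_min d0.
  by split; lra.
have g1pos t : 0 < t -> t < dl -> 0 < g1 t.
  move=> t0 tdl; have tn : t != 0 by rewrite gt_eqF.
  have tl : `|t| < dl by rewrite gtr0_norm.
  have := Hdl t tn tl; rewrite [t *: 1]mulr1 addr0 g10 subr0 ler_norml => /andP[H _].
  have : 0 < t^-1 * g1 t by lra.
  by rewrite pmulr_rgt0 // invr_gt0.
have [| |c] := @MVT R g g1 0 h h0.
- move=> t; rewrite in_itv /= => /andP[t0 th]; apply: Hg.
  by rewrite gtr0_norm // (lt_trans th).
- apply: derivable_within_continuous => t; rewrite in_itv /= => /andP[t0 th].
  have td : `|t| < d by rewrite ger0_norm // (le_lt_trans th).
  by have [] := Hg t td.
rewrite in_itv /= => /andP[c0 ch] E.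
have hmax : g h <= g 0 by apply: gmax; rewrite gtr0_norm.
have : 0 < g1 c * (h - 0).
  by rewrite subr0 mulr_gt0 // g1pos // (lt_trans ch).
by rewrite -E; lra.
Qed.

(** Translates decay in the sup norm into decay outside Euclidean balls, through [sqn x <= n |x|^2]
    and [Rr <= Rr^2] for [Rr >= 1]. *)
Lemma far {n} (r : R) : exists2 R0 : R, 1 <= R0 &
  forall Rr, R0 <= Rr -> forall x : 'rV[R]_n, Rr ^+ 2 <= sqn x -> r < `|x|.
Proof.
exists (n%:R * r ^+ 2 + 1 + 1); first by have := mulr_ge0 (ler0n R n) (sqr_ge0 r); lra.
have P0 := mulr_ge0 (ler0n R n) (sqr_ge0 r).
move=> Rr hR x hx; rewrite ltNge; apply/negP => xr.
have h : sqn x <= n%:R * r ^+ 2.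
  apply: le_trans (sqn_le_norm x) _; rewrite ler_wpM2l // ler_pXn2r ?nnegrE //.
  exact: le_trans xr.
have : Rr <= Rr ^+ 2 by rewrite expr2 ler_peMl //; lra.
lra.
Qed.

Variable n : nat.
Implicit Types v u : 'rV[R]_n -> R.

Lemma is_derive_sqn_invX i k (x : 'rV[R]_n) : sqn x != 0 ->
  is_derive x (evec R i) (fun x => (sqn x)^-1 ^+ k)
    (- (k%:R * (sqn x)^-1 ^+ k.+1) * (2 * x 0 i)).
Proof.
move=> xs; have [Cs Es] := @C1_sqn R n.
have dsqn : is_derive x (evec R i) (@sqn R n) (2 * x 0 i).
  by rewrite -[2 * _]/((fun x : 'rV[R]_n => 2 * x 0 i) x) -(Es i); exact: C1_is_derive.
have H := is_derive_invX k xs.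
refine (is_derive_comp H dsqn).
Qed.

(* [sqn x ^- m] is strictly superharmonic when [2 m + 2 < n]. *)
Lemma comparison v (m : nat) (s0 M : R) : (0 < m)%N -> (2 * m + 2 < n)%N ->
  C2 v -> 0 < s0 -> 0 < M ->
  (forall x, s0 <= sqn x -> 0 < v x -> 0 <= laplacian v x) ->
  (forall x, s0 <= sqn x -> v x <= M) -> vanishes_at_infinity v ->
  forall x, s0 <= sqn x -> v x * sqn x ^+ m <= M * s0 ^+ m.
Proof.
move=> m0 mn C2v s00 M0 lapv vM v0 x1 x1s; have [C1v C1pv] := C2v.
set C := M * s0 ^+ m; have C0 : 0 < C by rewrite mulr_gt0 // exprn_gt0.
rewrite leNgt; apply/negP => hx1.
(* [q] is the maximum of [sqn] and [s0]; it removes the singularity at the origin, so that [b] is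
   continuous everywhere. *)
pose q (x : 'rV[R]_n) := pospow 1 (sqn x - s0) + s0.
have qE x : s0 <= sqn x -> q x = sqn x.
  rewrite /q /pospow => xs; case: ifP; first by rewrite expr1 subrK.
  by move/negbT; rewrite -leNgt => h; apply/eqP; rewrite eq_le; apply/andP; split; lra.
have csq : continuous (@sqn R n) := C1_cont (@C1_sqn R n).1.
pose b x := v x - C * (q x)^-1 ^+ m.
have cb : continuous b.
  apply: contB; first exact: C1_cont.
  apply: contM; [exact: cont_cst|apply: contX; apply: contV].
    apply: contD; last exact: cont_cst.
    by apply: (cont_comp _ pospow1_cont); apply: contB => //; exact: cont_cst.
  by move=> x; rewrite gt_eqF // ltr_wpDl // pospow_ge0.
have s10 : 0 < sqn x1 by exact: lt_le_trans s00 x1s.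
have bx1 : 0 < b x1.
  by rewrite /b qE // subr_gt0 exprVn ltr_pdivrMr // exprn_gt0.
have e0 : 0 < b x1 / 2 by rewrite divr_gt0.
have [r Hr] := v0 _ e0.
have Cle x : s0 <= sqn x -> b x < v x.
  move=> xs; rewrite /b qE // ltrBlDr ltrDl mulr_gt0 // exprn_gt0 // invr_gt0.
  exact: lt_le_trans xs.
have inside x : s0 <= sqn x -> b x1 <= b x -> `|x| <= `|r|.
  move=> xs bx; rewrite leNgt; apply/negP => h; have rr := ler_norm r.
  have : `|v x| < b x1 / 2 by apply: Hr; lra.
  by have := ler_norm (v x); have := Cle _ xs; lra.
(* Points where [b] is at least [b x1] have norm at most [|r|]; the extra unit leaves room to move
   around the maximum without leaving [A]. *)
pose A := [set x : 'rV[R]_n | s0 <= sqn x /\ `|x| <= `|r| + 1]%classic.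
have x1A : A x1 by split=> //; have := inside _ x1s (lexx _); lra.
have cA : compact A.
  apply: (@subclosed_compact _ A [set x : 'rV[R]_n | `|x| <= `|r| + 1]%classic).
  - apply: closedI.
      exact: (closed_comp (fun x _ => csq x) (@closed_ge _ s0)).
    exact: (closed_comp (fun x _ => @norm_continuous _ _ x) (@closed_le _ (`|r| + 1))).
  - exact: closed_ball_rV_compact.
  - by move=> x [].
have [|c] := EVT_max_rV _ cA (continuous_subspaceT cb); first by exists x1.
rewrite inE => -[cs cr1] cmax.
have bc : b x1 <= b c by apply: cmax; rewrite inE.
have cr := inside _ cs bc.
(* On the inner sphere [C / s0^m = M] bounds [v], so [b <= 0] there and the maximum is interior. *)
have cs' : s0 < sqn c.
  rewrite lt_neqAle cs andbT; apply/eqP => E.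
  have := lt_le_trans bx1 bc; rewrite /b qE // -E /C exprVn mulfK; last first.
    by rewrite expf_neq0 // gt_eqF.
  by have := vM _ cs; lra.
have vc0 : 0 < v c by apply: lt_trans (Cle _ cs); exact: lt_le_trans bx1 bc.
have ds0 : 0 < sqn c - s0 by rewrite subr_gt0.
have /continuous_epsP/(_ _ ds0)[d1 d10 Hd1] := csq c.
pose d := Num.min d1 1.
have d0 : 0 < d by rewrite lt_min d10 ltr01.
have near_c i (t : R) : `|t| < d -> s0 < sqn (t *: evec R i + c) /\ A (t *: evec R i + c).
  rewrite lt_min => /andP[td1 t1].
  have ti : `|t *: evec R i| <= `|t| by rewrite normrZ ler_piMr // norm_evec_le1.
  have H : s0 < sqn (t *: evec R i + c).
    have : `|sqn (t *: evec R i + c) - sqn c| < sqn c - s0.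
      by apply: Hd1; rewrite addrK (le_lt_trans ti).
    by rewrite ltr_norml => /andP[]; lra.
  split=> //; split; first exact: ltW.
  by apply: le_trans (ler_normD _ _) _; lra.
have pos x : s0 < sqn x -> sqn x != 0 by move=> h; rewrite gt_eqF // (lt_trans s00).
pose Phi x := v x - C * (sqn x)^-1 ^+ m.
pose Phi1 i x := partial i v x + C * 2 * m%:R * ((sqn x)^-1 ^+ m.+1 * x 0 i).
pose Phi2 i x := partial i (partial i v) x + C * 2 * m%:R *
  ((sqn x)^-1 ^+ m.+1 - 2 * m.+1%:R * (sqn x)^-1 ^+ m.+2 * x 0 i ^+ 2).
have dPhi i x : sqn x != 0 -> is_derive x (evec R i) Phi (Phi1 i x).
  move=> xs; apply: (is_derive_eq (is_deriveB (C1_is_derive i x C1v)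
    (is_deriveM (is_derive_cst C x (evec R i)) (is_derive_sqn_invX i m xs)))).
  by rewrite !scaleRE /Phi1 /cst /=; ring.
have dPhi1 i x : sqn x != 0 -> is_derive x (evec R i) (Phi1 i) (Phi2 i x).
  move=> xs; have [Cx Ex] := @C1_coord R n i.
  have dx : is_derive x (evec R i) (fun x : 'rV[R]_n => x 0 i) 1.
    by have := C1_is_derive i x Cx; rewrite Ex eqxx.
  apply: (is_derive_eq (is_deriveD (C1_is_derive i x (C1pv i))
    (is_deriveM (is_derive_cst (C * 2 * m%:R) x (evec R i))
      (is_deriveM (is_derive_sqn_invX i m.+1 xs) dx)))).
  rewrite !scaleRE /Phi2 mulrfctE /cst /=.
  by ring.
have Phi2_le0 i : Phi2 i c <= 0.
  apply: (@second_derivative_at_max (fun t => Phi (t *: evec R i + c))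
    (fun t => Phi1 i (t *: evec R i + c)) _ d d0).
  - by move=> t /near_c -/(_ i)[ts _]; apply: is_derive_line; apply: dPhi; exact: pos.
  - by apply: is_derive_line; rewrite scale0r add0r; apply: dPhi1; exact: pos.
  - move=> t /near_c -/(_ i)[ts tA]; rewrite scale0r add0r.
    have := cmax (t *: evec R i + c); rewrite inE => /(_ tA).
    by rewrite /b !qE // ltW.
(* The sum is the Laplacian of [v - C sqn^-m]: a nonnegative term plus
   [2 m C sqn^-(m+1) (n - 2 m - 2)], which is positive. *)
have : \sum_(i < n) Phi2 i c <= 0 by apply: sumr_le0 => i _; exact: Phi2_le0.
rewrite big_split /= -/(laplacian v c) -mulr_sumr sumrB sumr_const card_ord -mulr_sumr.
rewrite -/(sqn c).
have lc := lapv _ cs vc0.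
have S0 : 0 < (sqn c)^-1 by rewrite invr_gt0 (lt_trans s00).
have -> : (sqn c)^-1 ^+ m.+1 *+ n - 2 * m.+1%:R * (sqn c)^-1 ^+ m.+2 * sqn c =
   (sqn c)^-1 ^+ m.+1 * (n%:R - 2 * m.+1%:R).
  rewrite -mulr_natr !exprS; field; exact: pos.
have h1 : 0 < n%:R - 2 * m.+1%:R :> R.
  by rewrite subr_gt0 -natrM ltr_nat mulnS addnC.
have : 0 < C * 2 * m%:R * ((sqn c)^-1 ^+ m.+1 * (n%:R - 2 * m.+1%:R)).
  by rewrite !mulr_gt0 ?exprn_gt0 ?ltr0n.
lra.
Qed.

Lemma fu_le0 (f : R -> R) (delta : R) : C1R f -> f 0 = 0 ->
  (forall s, `|s| < delta -> f^`()%classic s <= 0) ->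
  forall s, `|s| < delta -> f s * s <= 0.
Proof.
move=> Cf f0 fd s sd.
have [th ths E] := @dir_MVT R R^o f (fun t => f^`()%classic t) 0 1 s (fun y => C1R_is_derive Cf y).
have E' : f s = s * f^`()%classic th.
  by move: E; rewrite !addr0 f0 subr0 ![_ *: 1]mulr1.
rewrite E' mulrAC -expr2 mulr_ge0_le0 ?sqr_ge0 // fd //.
exact: le_lt_trans ths sd.
Qed.

(** [Rr ^+ n] stands for the volume of an annulus and [Rr ^+ 4] for the gain from two cutoffs. For
    [n <= 4] smallness of [u] suffices; otherwise the one-sided [comparison] is applied to [u] and
    to [- u]. *)
Lemma decay (f : R -> R) u (delta : R) : C2 u ->
  (forall x, laplacian u x + f (u x) = 0) -> vanishes_at_infinity u -> 0 < delta ->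
  (forall s, `|s| < delta -> f s * s <= 0) ->
  forall e : R, 0 < e -> exists2 R0 : R, 1 <= R0 &
    forall Rr, R0 <= Rr -> forall x, Rr ^+ 2 <= sqn x -> u x ^+ 2 * Rr ^+ n <= e * Rr ^+ 4.
Proof.
move=> C2u eqn u0 delta0 fs e e0; have [n4|n4] := leqP n 4.
  pose eta := Num.min 1 e.
  have eta0 : 0 < eta by rewrite lt_min ltr01.
  have [r Hr] := u0 _ eta0; have [R0 R01 HR0] := @far n r.
  exists R0 => // Rr hR x hx; have R1 : 1 <= Rr by exact: le_trans hR.
  have ux : `|u x| < eta by apply: Hr; exact: HR0 hx.
  rewrite ler_pM ?sqr_ge0 ?exprn_ge0 //; first by lra.
    rewrite -[u x ^+ 2]real_normK ?num_real //.
    apply: (@le_trans _ _ (eta ^+ 2)); first by have := normr_ge0 (u x); move: `|u x| ux => t; nra.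
    have [h1 h2] : eta <= 1 /\ eta <= e by rewrite !ge_min !lexx orbT.
    by rewrite expr2; nra.
  by rewrite ler_weXn2l.
have [r Hr] := u0 _ delta0; have [R1 R11 HR1] := @far n r.
(* This choice meets both needs: [2 m + 2 < n] for superharmonicity, and [n <= 4 m + 3] so that
   [u^2 Rr^n] is at most a constant times [Rr^3]. *)
pose m := (n %/ 4)%N.
have m0 : (0 < m)%N by rewrite /m; clear -n4; lia.
have mn : (2 * m + 2 < n)%N by rewrite /m; clear -n4; lia.
have nm : (n <= 4 * m + 3)%N by rewrite /m; clear -n4; lia.
have s00 : 0 < R1 ^+ 2 by rewrite exprn_gt0 // (lt_le_trans ltr01).
have ud x : R1 ^+ 2 <= sqn x -> `|u x| < delta.
  by move=> hx; apply: Hr; exact: HR1 (lexx _) _ hx.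
have B1 : forall x, R1 ^+ 2 <= sqn x -> u x * sqn x ^+ m <= delta * (R1 ^+ 2) ^+ m.
  apply: comparison => //.
  - move=> x hx ux; have := fs _ (ud _ hx); rewrite pmulr_lle0 // => h.
    by have := eqn x; lra.
  - by move=> x /ud; rewrite ltr_norml => /andP[_ /ltW].
have B2 : forall x, R1 ^+ 2 <= sqn x -> - u x * sqn x ^+ m <= delta * (R1 ^+ 2) ^+ m.
  have [C1u C1pu] := C2u.
  have [CN EN] := C1Z (-1) C1u.
  have NE : (fun x => -1 * u x) = (fun x => - u x) by apply/funext => x; rewrite mulN1r.
  rewrite NE in CN EN.
  have C2N : C2 (fun x => - u x).
    split; first exact: CN.
    by move=> i; rewrite (EN i); exact: (C1Z (-1) (C1pu i)).1.
  have lapN x : laplacian (fun x => - u x) x = - laplacian u x.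
    rewrite /laplacian -sumrN; apply: eq_bigr => i _; rewrite (EN i).
    by rewrite ((C1Z (-1) (C1pu i)).2 i) mulN1r.
  apply: comparison => //.
  - move=> x hx; rewrite oppr_gt0 => ux; have := fs _ (ud _ hx).
    rewrite nmulr_lle0 // lapN => h; by have := eqn x; lra.
  - by move=> x /ud; rewrite ltr_norml => /andP[/ltW ? _]; lra.
  - by move=> t t0; have [r' H] := u0 t t0; exists r' => x /H; rewrite normrN.
pose B := delta * (R1 ^+ 2) ^+ m.
have B0 : 0 < B by rewrite mulr_gt0 // exprn_gt0.
(* The bound [B^2 Rr^3] is below [e Rr^4] as soon as [Rr >= B^2 / e]. *)
exists (R1 + B ^+ 2 / e); first by rewrite ler_wpDr // divr_ge0 ?sqr_ge0 // ltW.
move=> Rr hR x hx.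
have Be : 0 <= B ^+ 2 / e by rewrite divr_ge0 ?sqr_ge0 // ltW.
have Rr1 : 1 <= Rr by lra.
have Rr0 : 0 <= Rr by lra.
have hx' : R1 ^+ 2 <= sqn x.
  by apply: le_trans hx; rewrite ler_pXn2r ?nnegrE //; lra.
have ub : `|u x| * sqn x ^+ m <= B.
  have [h|h] := leP 0 (u x).
    by rewrite (ger0_norm h); exact: B1.
  by rewrite (ltr0_norm h); exact: B2.
have ub2 : u x ^+ 2 * Rr ^+ (4 * m) <= B ^+ 2.
  have P0 : 0 <= `|u x| * sqn x ^+ m by rewrite mulr_ge0 // exprn_ge0 // sqn_ge0.
  apply: (@le_trans _ _ ((`|u x| * sqn x ^+ m) ^+ 2)); last first.
    by rewrite ler_pXn2r ?nnegrE // ltW.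
  rewrite exprMn real_normK ?num_real // ler_wpM2l ?sqr_ge0 //.
  have -> : Rr ^+ (4 * m) = ((Rr ^+ 2) ^+ m) ^+ 2.
    by rewrite -!exprM; congr (_ ^+ _); clear; lia.
  have Q0 : 0 <= (Rr ^+ 2) ^+ m by rewrite exprn_ge0 // sqr_ge0.
  rewrite ler_pXn2r ?nnegrE ?exprn_ge0 ?sqr_ge0 ?sqn_ge0 //.
  by rewrite lerXn2r ?nnegrE ?sqr_ge0 ?sqn_ge0.
apply: (@le_trans _ _ (u x ^+ 2 * Rr ^+ (4 * m + 3))).
  by rewrite ler_wpM2l ?sqr_ge0 // ler_weXn2l.
rewrite exprD mulrA; apply: (@le_trans _ _ (B ^+ 2 * Rr ^+ 3)).
  by rewrite ler_wpM2r // exprn_ge0.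
have -> : e * Rr ^+ 4 = (e * Rr) * Rr ^+ 3 by ring.
rewrite ler_wpM2r ?exprn_ge0 //.
have : B ^+ 2 / e <= Rr by lra.
by rewrite ler_pdivrMr // mulrC.
Qed.

End comparison.

(** * Sign of the partial derivatives *)

Section sign_of_derivative.
Context {R : realType} {n : nat}.
Variables (f : R -> R) (u : 'rV[R]_n -> R) (delta : R).
Hypotheses (Cf : C1R f) (Cu : C2 u).
Hypothesis eqn : forall x, laplacian u x + f (u x) = 0.
Hypotheses (u0 : vanishes_at_infinity u) (delta0 : 0 < delta).
Hypothesis fs : forall s, `|s| < delta -> f s * s <= 0.
Local Notation I := (@integral_Rn R n).

Let c x := f^`()%classic (u x).

Definition eta (r : R) (x : 'rV[R]_n) := step ((r ^+ 2)^-1 * sqn x).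

Lemma eta_C1 r : C1 (eta r).
Proof.
have cN : continuous (fun t : R => - dstep t) by apply: contN; exact: dstep_cont.
by have [C _] := @C1_scaled R n step (fun t => - dstep t) (r ^+ 2)^-1 is_derive_step cN.
Qed.

Lemma eta_Cc r : 0 < r -> Cc (eta r).
Proof.
move=> r0; split; first exact: C1_cont (eta_C1 r).
exists (2 * r); first by rewrite mulr_ge0 // ltW.
by apply: scaled_supp => // t t2; rewrite step_eq0 // ltW.
Qed.

(** The gradient of [eta r] is controlled by [z = dstep (l sqn)], a cutoff living on the annulus
    [1 <= l sqn <= 2]. There [f(u) u <= 0], so [Caccioppoli] with this [z] passes from [grad u] to
    [u], and [decay] bounds the result. *)
Lemma gradient_tail (i : 'I_n) (e : R) : 0 < e -> exists2 R0 : R, 1 <= R0 &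
  forall r, R0 <= r -> I (fun x => partial i u x ^+ 2 * grad_sq (eta r) x) <= e.
Proof.
move=> e0; have [C1u C1pu] := Cu.
(* Product of the losses: 8 from [|grad eta|^2], 4 from [Caccioppoli], [8 * 72 ^+ 2] from
   [|grad z|^2], and [4 ^+ n] from the volume [(4 r)^n] of a cube containing the support. The powers
   of [r] cancel. *)
pose K : R := 32 * 8 * 72 ^+ 2 * 4 ^+ n.
have K0 : 0 < K by rewrite !mulr_gt0 ?exprn_gt0.
have eK0 : 0 < e / K by rewrite divr_gt0.
have [R1 R11 HR1] := decay Cu eqn u0 delta0 fs eK0.
have [r1 Hr1] := u0 delta0; have [R2 R21 HR2] := @far R n r1.
exists (Num.max R1 R2); first by rewrite le_max R11.
move=> r; rewrite ge_max => /andP[R1r R2r].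
have r1' : 1 <= r by exact: le_trans R1r.
have r0 : 0 < r by exact: lt_le_trans r1'.
pose l := (r ^+ 2)^-1; have l0 : 0 < l by rewrite invr_gt0 exprn_gt0.
pose z (x : 'rV[R]_n) := dstep (l * sqn x).
have [C1z gz] := @C1_scaled R n dstep ddstep l is_derive_dstep ddstep_cont.
rewrite -/z in C1z gz.
have cN : continuous (fun t : R => - dstep t) by apply: contN; exact: dstep_cont.
have [C1e ge] := @C1_scaled R n step (fun t => - dstep t) l is_derive_step cN.
have Cz : Cc z.
  split; first exact: C1_cont.
  exists (2 * r); first by rewrite mulr_ge0 // ltW.
  apply: scaled_supp => // t t2; apply/eqP; apply: contraTT t2 => /dstep_supp[_].
  by rewrite -leNgt.
have Ceta := eta_Cc r0.
have annulus (x : 'rV[R]_n) : 1 <= l * sqn x -> r ^+ 2 <= sqn x.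
  by rewrite /l mulrC ler_pdivlMr ?exprn_gt0 // mul1r.
have zu x : z x != 0 -> f (u x) * u x <= 0.
  move=> /dstep_supp[/annulus h _]; apply: fs; apply: Hr1; exact: HR2 R2r _ h.
have Cacc := Caccioppoli Cf Cu eqn C1z Cz zu.
have CA : Cc (fun x => partial i u x ^+ 2 * grad_sq (eta r) x).
  rewrite grad_sqE; apply: CcMl; last by apply: gradM_Cc => //; exact: eta_C1.
  by apply: contX; exact: C1_partial_cont C1u.
have CB : Cc (fun x => grad_sq u x * z x ^+ 2).
  rewrite grad_sqE; under [fun _ => _]funext do rewrite expr2.
  apply: CcMl; first exact: gradM_cont.
  by apply: CcMl => //; exact: C1_cont.
have H1 : I (fun x => partial i u x ^+ 2 * grad_sq (eta r) x) <=
    8 * l * I (fun x => grad_sq u x * z x ^+ 2).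
  rewrite -intZ //; apply: int_le => //; first exact: CcZ.
  move=> x; rewrite [grad_sq (eta r) x]ge sqrrN -/(z x).
  have hi : partial i u x ^+ 2 <= grad_sq u x.
    rewrite /grad_sq (bigD1 i) //= lerDl; apply: sumr_ge0 => j _; exact: sqr_ge0.
  have hz : l * sqn x * z x ^+ 2 <= 2 * z x ^+ 2.
    have [->|/dstep_supp[_ h]] := eqVneq (z x) 0; first by rewrite expr0n !mulr0.
    by rewrite ler_wpM2r // sqr_ge0.
  have -> : 8 * l * (grad_sq u x * z x ^+ 2) = grad_sq u x * (4 * l * (2 * z x ^+ 2)) by ring.
  have -> : 4 * l ^+ 2 * sqn x * z x ^+ 2 = 4 * l * (l * sqn x * z x ^+ 2) by ring.
  rewrite ler_pM ?sqr_ge0 //.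
    apply: mulr_ge0; first by rewrite mulr_ge0 // ltW.
    by apply: mulr_ge0; [rewrite mulr_ge0 ?sqn_ge0 // ltW|exact: sqr_ge0].
  by rewrite ler_wpM2l // mulr_ge0 // ltW.
have H2 : `|I (fun x => u x ^+ 2 * grad_sq z x)| <=
    8 * l * 72 ^+ 2 * (e / K * r ^+ 4 / r ^+ n) * (2 * (2 * r)) ^+ n.
  have rn0 : 0 < r ^+ n by rewrite exprn_gt0.
  have b0 : 0 <= 8 * l * 72 ^+ 2 * (e / K * r ^+ 4 / r ^+ n).
    apply: mulr_ge0.
      by apply: mulr_ge0; [rewrite mulr_ge0 // ltW|exact: exprn_ge0].
    apply: mulr_ge0; last by rewrite invr_ge0 ltW.
    by apply: mulr_ge0; [exact: ltW|rewrite exprn_ge0 // ltW].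
  apply: int_bound.
  - by rewrite mulr_ge0 // ltW.
  - rewrite grad_sqE; apply: contM; last exact: gradM_cont.
    by apply: contX; exact: C1_cont C1u.
  - move=> x rx; rewrite gz.
    rewrite (@scaled_supp R n ddstep r) // ?expr0n ?mulr0 // => t t2.
    by apply/eqP; apply: contraTT t2 => /ddstep_supp[_]; rewrite -leNgt.
  - move=> x; rewrite gz.
    have [->|dd] := eqVneq (ddstep (l * sqn x)) 0.
      by rewrite expr0n !mulr0 normr0.
    have [/annulus h1 h2] := ddstep_supp dd.
    have hu := HR1 _ R1r _ h1.
    have hu' : u x ^+ 2 <= e / K * r ^+ 4 / r ^+ n by rewrite ler_pdivlMr.
    have g0 : 0 <= 4 * l ^+ 2 * sqn x * ddstep (l * sqn x) ^+ 2.
      apply: mulr_ge0; last exact: sqr_ge0.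
      by apply: mulr_ge0; [rewrite mulr_ge0 ?sqr_ge0|exact: sqn_ge0].
    rewrite (ger0_norm (mulr_ge0 (sqr_ge0 _) g0)).
    rewrite mulrC ler_pM ?sqr_ge0 //.
    have -> : 4 * l ^+ 2 * sqn x * ddstep (l * sqn x) ^+ 2 =
      4 * l * (l * sqn x) * ddstep (l * sqn x) ^+ 2 by ring.
    have -> : 8 * l * 72 ^+ 2 = 4 * l * 2 * 72 ^+ 2 by ring.
    rewrite ler_pM ?sqr_ge0 //.
    + by rewrite !mulr_ge0 ?sqn_ge0 // ltW.
    + by rewrite ler_wpM2l // mulr_ge0 // ltW.
    + rewrite -[ddstep _ ^+ 2]real_normK ?num_real //.
      have := ddstep_bound (l * sqn x); have := normr_ge0 (ddstep (l * sqn x)).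
      by move: `|_| => t t0 t1; nra.
apply: le_trans H1 _.
apply: (@le_trans _ _
  (8 * l * (4 * (8 * l * 72 ^+ 2 * (e / K * r ^+ 4 / r ^+ n) * (2 * (2 * r)) ^+ n)))).
  rewrite ler_wpM2l ?mulr_ge0 ?(ltW l0) // (le_trans Cacc) // ler_wpM2l //.
  by apply: le_trans H2; exact: ler_norm.
have -> : (2 * (2 * r)) ^+ n = 4 ^+ n * r ^+ n by rewrite mulrA -exprMn; congr (_ ^+ n); ring.
rewrite le_eqVlt; apply/orP; left; apply/eqP.
rewrite /l /K; field.
by rewrite !gt_eqF ?exprn_gt0.
Qed.

(* The test function [eta r * G (partial i u) + t * barrier] is admissible for stability.  As the
   energy of its first summand is small and the barrier is a strict subsolution on
   [{partial i u > 0}], a change of sign of [partial i u] would make its energy negative. *)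
Lemma partial_sign (i : 'I_n) : stable f u ->
  (forall x, 0 <= partial i u x) \/ (forall x, partial i u x <= 0).
Proof.
move=> st; have [C1u C1pu] := Cu; set w := partial i u.
have [wpos|] := pselect (forall x, 0 <= w x); first by left.
have [wneg|] := pselect (forall x, w x <= 0); first by right.
move=> /existsNP[z0 /negP]; rewrite -ltNge => wz0.
move=> /existsNP[y0 /negP]; rewrite -ltNge => wy0.
exfalso.
have cw : continuous w := C1_cont (C1pu i).
have cc : continuous c by apply: (cont_comp _ Cf.2); exact: C1_cont C1u.
have Nwy0 : 0 < - w y0 by rewrite oppr_gt0.
have /continuous_epsP/(_ _ Nwy0)[d d0 Hd] := cw y0.
(* [w] is negative near [y0], so the centre, where the barrier fails to be a subsolution, is outside
   [{w > 0}]. *)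
have far_y x : 0 < w x -> d ^+ 2 <= sqn (x - y0).
  move=> wx; rewrite leNgt; apply/negP => /(sqn_norm_lt d0)/Hd.
  by rewrite ltr_norml => /andP[]; lra.
(* The support of the barrier must contain [z0], where [w > 0], to make [kappa] positive. *)
pose T := sqn (z0 - y0) + 1.
have T1 : 1 <= T by rewrite lerDr sqn_ge0.
have T0 : 0 < T by exact: lt_le_trans T1.
have [K K0 HK] := continuous_bounded_rV (`|y0| + T) cc.
have [m hm] : exists m : nat, 2 * n%:R * T + K * T ^+ 2 < 4 * d ^+ 2 * m.+2%:R.
  have d20 : 0 < 4 * d ^+ 2 by rewrite mulr_gt0 // exprn_gt0.
  have h0 : 0 <= (2 * n%:R * T + K * T ^+ 2) / (4 * d ^+ 2).
    by rewrite divr_ge0 ?(ltW d20) // addr_ge0 // mulr_ge0 ?sqr_ge0 ?mulr_ge0 // ltW.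
  exists (Num.bound ((2 * n%:R * T + K * T ^+ 2) / (4 * d ^+ 2))).
  have := archi_boundP h0; rewrite ltr_pdivrMr // => h.
  apply: (lt_le_trans h); rewrite mulrC ler_pM2l // ler_nat.
  exact: leqW (leqW (leqnn _)).
pose chi := barrier y0 T m.
have [[C1chi C1pchi] _] := barrier_C2 y0 T m; rewrite -/chi in C1chi C1pchi.
have [Cchi Clap] := barrier_Cc y0 m T1; rewrite -/chi in Cchi Clap.
have chi_pos x : 0 < w x -> 0 < T - sqn (x - y0) -> 0 < laplacian chi x + c x * chi x.
  move=> wx tx; apply: (barrier_subsol K0 T0 _ hm (far_y x wx) tx); first exact: exprn_gt0.
  have := HK x (ltW (barrier_norm T1 tx)).
  by rewrite ler_norml => /andP[].
have chi_out x : T - sqn (x - y0) <= 0 -> laplacian chi x + c x * chi x = 0.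
  by move=> tx; rewrite (barrier_C2 y0 T m).2 /chi /barrier !pospow_le0 // !mulr0 subr0 addr0.
pose L x := laplacian chi x + c x * chi x.
have CL : Cc L by apply: CcD => //; exact: CcMl.
(* The truncation for [e = 1], a lower bound for all later ones; hence [kappa] and [t] are fixed
   before [r] and [e]. *)
pose g1 (s : R) : R := pospow 2 s / (pospow 1 s + 1).
have g1_ge0 s : 0 <= g1 s by rewrite divr_ge0 ?addr_ge0 ?pospow_ge0.
have g1_gt0 s : 0 < s -> 0 < g1 s.
  by move=> s0; rewrite /g1 !pospow_gt0 // divr_gt0 ?exprn_gt0 // expr1 addr_gt0.
have g1_le0 s : s <= 0 -> g1 s = 0 by move=> s0; rewrite /g1 pospow_le0 ?mul0r.
have cg1 : continuous g1.
  apply: contM; first exact: pospow_cont.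
  apply: contV; first by apply: contD; [exact: pospow1_cont|exact: cont_cst].
  by move=> s; rewrite gt_eqF // ltr_wpDl // pospow_ge0.
have CgL : Cc (fun x => g1 (w x) * L x) by apply: CcMl => //; exact: cont_comp cw cg1.
have gL_ge0 x : 0 <= g1 (w x) * L x.
  have [wx|wx] := leP (w x) 0; first by rewrite g1_le0 // mul0r.
  have [tx|tx] := leP (T - sqn (x - y0)) 0; first by rewrite /L chi_out // mulr0.
  by rewrite mulr_ge0 // ltW // chi_pos.
pose kappa := I (fun x => g1 (w x) * L x).
have kappa0 : 0 < kappa.
  apply: (@int_gt0 _ _ _ z0) => //; rewrite mulr_gt0 ?g1_gt0 // chi_pos //.
  by rewrite /T addrAC subrr add0r.
pose Qchi := Qform c chi.
have q0 : 0 < `|Qchi| + 1 by rewrite ltr_wpDl.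
(* The gain is linear in [t] and the cost [t^2 Qchi] quadratic; this [t] makes the cost at most
   [t kappa]. *)
pose t := kappa / (`|Qchi| + 1); have t0 : 0 < t by rewrite divr_gt0.
have tQ : t * Qchi <= kappa.
  apply: (@le_trans _ _ (t * (`|Qchi| + 1))); last by rewrite /t divfK // gt_eqF.
  by rewrite ler_pM2l //; have := ler_norm Qchi; lra.
have tk0 : 0 < t * kappa / 4 by rewrite divr_gt0 // mulr_gt0.
have [R0 R01 HR0] := gradient_tail i tk0.
pose rho := `|y0| + T; have rho0 : 0 <= rho by rewrite addr_ge0 // ltW.
(* The second entry makes [eta r] equal to 1 on the support of the barrier. *)
pose r := Num.max R0 (n%:R * rho ^+ 2).
have rR0 : R0 <= r by rewrite le_max lexx.
have r1 : 1 <= r by exact: le_trans rR0.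
have r0 : 0 < r by exact: lt_le_trans r1.
have eta1 x : 0 < T - sqn (x - y0) -> eta r x = 1.
  move=> /(barrier_norm T1) xr; apply: step1.
  rewrite mulrC ler_pdivrMr ?exprn_gt0 // mul1r.
  apply: le_trans (sqn_le_norm x) _; apply: (@le_trans _ _ (n%:R * rho ^+ 2)).
    by rewrite ler_wpM2l // ler_pXn2r ?nnegrE // ltW.
  have h : n%:R * rho ^+ 2 <= r by rewrite le_max lexx orbT.
  by apply: le_trans h _; rewrite expr2 ler_peMl // ltW.
pose B := I (fun x => `|c x| * eta r x ^+ 2 * `|w x|).
(* Chosen after [r], since [B] depends on [r]. *)
pose e := Num.min 1 (t * kappa / 4 / (`|B| + 1)).
have B0 : 0 < `|B| + 1 by rewrite ltr_wpDl.
have e0 : 0 < e by rewrite lt_min ltr01 /= divr_gt0.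
have e1 : e <= 1 by rewrite ge_min lexx.
have eB : e * B <= t * kappa / 4.
  apply: (@le_trans _ _ (e * (`|B| + 1))).
    by rewrite ler_pM2l //; have := ler_norm B; lra.
  by rewrite -ler_pdivlMr // ge_min lexx orbT.
have [G [G' [H [H' [[dG cG'] [dH cH'] [HE H'ge] [Gle Hle] [g1G G0]]]]]] := truncation_exists e0 e1.
have C1eta := eta_C1 r; have Ceta := eta_Cc r0.
have := truncated_energy Cf Cu eqn i dG cG' dH cH' HE H'ge Gle Hle C1eta Ceta.
rewrite -/w -/c -/B; set a := fun x => eta r x * G (w x) => Qa.
have [C1Gw _] := C1_comp dG cG' (C1pu i).
have [C1a _] := C1M C1eta C1Gw; rewrite -/w -/a in C1a.
have Ca : Cc a by exact: CcMr Ceta (C1_cont C1Gw).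
have [C1tchi Etchi] := C1Z t C1chi.
have [C1phi Ephi] := C1D C1a C1tchi.
have Cphi : Cc (fun x => a x + t * chi x) by apply: CcD => //; exact: CcZ.
have := stable_C1 st cc C1phi Cphi; rewrite -/c.
have Cga : Cc (gradM chi a) by exact: gradM_Cc.
have Ccca : Cc (fun x => c x * chi x * a x).
  by apply: CcMl => //; apply: contM => //; exact: C1_cont.
have CQa := Qform_Cc cc C1a Ca; have CQchi := Qform_Cc cc C1chi Cchi.
have CX : Cc (fun x => gradM chi a x - c x * chi x * a x) by exact: CcB.
have -> : Qform c (fun x => a x + t * chi x) =
    Qform c a + (2 * t * I (fun x => gradM chi a x - c x * chi x * a x) + t ^+ 2 * Qchi).
  rewrite /Qchi /Qform -(intZ (t ^+ 2) CQchi) -(intZ (2 * t) CX).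
  rewrite -intD; [|exact: CcZ|exact: CcZ].
  rewrite -intD //; last by apply: CcD; exact: CcZ.
  congr I; apply/funext => x.
  have -> : grad_sq (fun x => a x + t * chi x) x =
      grad_sq a x + 2 * t * gradM chi a x + t ^+ 2 * grad_sq chi x.
    rewrite /grad_sq /gradM !mulr_sumr -!big_split /=; apply: eq_bigr => j _.
    by rewrite Ephi Etchi; ring.
  ring.
have CLa : Cc (fun x => L x * a x) by apply: CcMr => //; exact: C1_cont.
have -> : I (fun x => gradM chi a x - c x * chi x * a x) = - I (fun x => L x * a x).
  have Cla : Cc (fun x => laplacian chi x * a x) by exact: CcMr Clap (C1_cont C1a).
  rewrite (intB Cga Ccca) (Green (conj C1chi C1pchi) C1a Ca) -opprD -(intD Cla Ccca).
  by congr (- I _); apply/funext => x; rewrite /L mulrDl.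
(* Where [w <= 0] both integrands vanish, so the unknown sign of [L] there is harmless; elsewhere
   [L >= 0] and [g1 <= G]. *)
have kLa : kappa <= I (fun x => L x * a x).
  apply: int_le => // x; have [tx|tx] := leP (T - sqn (x - y0)) 0.
    by rewrite /L chi_out // mulr0 mul0r.
  rewrite /a eta1 // mul1r mulrC.
  have [wx|wx] := leP (w x) 0; first by rewrite g1_le0 // G0 // !mulr0.
  by rewrite ler_wpM2l ?g1G //; exact: ltW (chi_pos x wx tx).
have := HR0 r rR0; rewrite -/w => tail Qphi.
have h1 : t * kappa <= t * I (fun x => L x * a x) by rewrite ler_pM2l.
have h2 : t ^+ 2 * Qchi <= t * kappa by rewrite expr2 -mulrA ler_pM2l.
have h3 : 2 * t * - I (fun x => L x * a x) = - 2 * (t * I (fun x => L x * a x)) by ring.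
(* The energy is at most [t kappa / 4 + t kappa / 4 - 2 t kappa + t kappa], which is negative. *)
rewrite h3 in Qphi; lra.
Qed.

End sign_of_derivative.

Lemma monotone_vanishing {R : realType} {n : nat} (u : 'rV[R]_n -> R) (i : 'I_n) :
  C1 u -> vanishes_at_infinity u ->
  (forall x, 0 <= partial i u x) \/ (forall x, partial i u x <= 0) -> forall x, u x = 0.
Proof.
move=> C1u u0 sgn x.
have D t := @dir_MVT R _ u (partial i u) x (evec R i) t (fun y => C1_is_derive i y C1u).
have far_line (e : R) : 0 < e -> exists2 t, 0 < t & `|u (t *: evec R i + x)| < e /\
    `|u ((- t) *: evec R i + x)| < e.
  move=> /u0[r Hr]; exists (`|r| + `|x| + 1); first by rewrite ltr_wpDl // addr_ge0.
  have out t : `|t| = `|r| + `|x| + 1 -> r < `|t *: evec R i + x|.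
    move=> tE; have := ler_normB (t *: evec R i + x) x; rewrite addrK.
    have : `|t| <= `|t *: evec R i|.
      have := coord_le_norm (t *: evec R i) i.
      by rewrite !mxE !eqxx /= mulr1.
    by have := ler_norm r; lra.
  have p0 : 0 <= `|r| + `|x| + 1 by rewrite !addr_ge0.
  by split; apply: Hr; apply: out; rewrite ?normrN ger0_norm.
apply/eqP; rewrite -normr_le0; apply/ler_addgt0Pr => e e0; rewrite add0r.
have [t t0 [h1 h2]] := far_line e e0.
have [th _ E1] := D t; have [th' _ E2] := D (- t).
move: h1 h2; rewrite !ltr_norml ler_norml => /andP[a1 a2] /andP[b1 b2].
case: sgn => sg.
- have : 0 <= t * partial i u (th *: evec R i + x) by rewrite mulr_ge0 // ltW.
  have : - t * partial i u (th' *: evec R i + x) <= 0.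
    by rewrite mulNr oppr_le0 mulr_ge0 // ltW.
  by rewrite -E1 -E2 => *; apply/andP; split; lra.
- have : t * partial i u (th *: evec R i + x) <= 0 by rewrite mulr_ge0_le0 // ltW.
  have : 0 <= - t * partial i u (th' *: evec R i + x).
    by rewrite mulNr oppr_ge0 mulr_ge0_le0 // ltW.
  by rewrite -E1 -E2 => *; apply/andP; split; lra.
Qed.

Theorem theorem1p1 (R : realType) (N : nat) (f : R -> R) (u : 'rV[R]_N -> R) :
  (1 <= N)%N ->
  C1R f -> f 0 = 0 ->
  (exists delta : R, 0 < delta /\ forall s : R, `|s| < delta -> derive1 f s <= 0) ->
  Ck 2 u ->
  (forall x, laplacian u x + f (u x) = 0) ->
  vanishes_at_infinity u ->
  stable f u ->
  forall x, u x = 0.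
Proof.
move=> N1 Cf f0 [delta [delta0 fd]] /Ck2_C2 Cu eqn u0 st.
have fs := fu_le0 Cf f0 fd.
(* [1 <= N] is by definition [0 < N], so [Ordinal N1] is the index 0 of the first axis. *)
apply: (@monotone_vanishing R N u (Ordinal N1) Cu.1 u0).
exact: partial_sign Cf Cu eqn u0 delta0 fs _ st.
Qed.
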